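(* Let $N,n\ge 1$ and let $L$ be a measurable function of $(\sigma^\ell)_{1\le\ell\le n}\in\Sigma_N^n$ with $\|L\|_\infty\le 1$. The following two statements hold. 1. Suppose that $\beta_2=\beta_3=0$ and $y$ has mean zero and variance one with $\mathbb{E}|y|^3<\infty$. Then $$|\mathbb{E}\langle L\rangle_g-\mathbb{E}\langle L\rangle_y|\le\frac{3nC_{2,2n}\,\mathbb{E}|y|^3}{2N^{1/2}}\sum_{p\ge4}\beta_p^3 .$$ 2. Suppose that the first four moments of $y$ match the first four moments of a standard Gaussian random variable. Then $$|\mathbb{E}\langle L\rangle_g-\mathbb{E}\langle L\rangle_y|\le 2nC_{3,2n}\,\mathbb{E}\big[|y|^4;|y|\ge N^{1/4}\big]\sum_{p\ge2}\beta_p^4+\frac{5nC_{4,2n}\,\mathbb{E}|y|^4}{24N^{1/4}}\sum_{p\ge2}\beta_p^5 .$$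
   Context: Mixed $p$-spin model: let $\Sigma_N=\{-1,1\}^N$, let $(\beta_p)_{p\ge2}$ be nonnegative numbers with $\sum_{p\ge2}2^p\beta_p^2<\infty$, and let $h\in\mathbb{R}$. For independent, identically distributed random variables $y_{i_1,\ldots,i_p}$ ($p\ge2$, $1\le i_1,\ldots,i_p\le N$) with common law that of a random variable $y$ with mean zero and variance one, the Hamiltonian is $$X(\sigma)=\sum_{p\ge2}\frac{\beta_p}{N^{(p-1)/2}}\sum_{1\le i_1,\ldots,i_p\le N}y_{i_1,\ldots,i_p}\sigma_{i_1}\cdots\sigma_{i_p}+h\sum_{i=1}^N\sigma_i,\qquad \sigma\in\Sigma_N,$$ with Gibbs measure $G(\sigma)=\exp(X(\sigma))/\sum_{\sigma'\in\Sigma_N}\exp(X(\sigma'))$. $\langle\cdot\rangle_y$ denotes the expectation over i.i.d. samples (replicas) $\sigma^1,\sigma^2,\ldots$ from this Gibbs measure, conditionally on the disorder; $\langle\cdot\rangle_g$ denotes the same object when the disorder variables are i.i.d. standard Gaussian. $\mathbb{E}$ is the expectation over the disorder, $\mathbb{E}[X;A]=\mathbb{E}[X\mathbf 1_A]$, and $C_{k,m}:=2^{k(k+1)/2}m^k$. *)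

(* Defs.v *)
From HB Require Import structures.
From mathcomp Require Export all_boot all_order all_algebra.
From mathcomp Require Export all_classical all_reals all_analysis.
Export numFieldNormedType.Exports.
Export Order.TTheory GRing.Theory Num.Theory.

Set Implicit Arguments.
Unset Strict Implicit.
Unset Printing Implicit Defensive.

Local Open Scope classical_set_scope.
Local Open Scope ring_scope.

(* The product rule is required for every finite subfamily with indices in D;
   the members of the family outside D are unconstrained. *)
Definition mutually_independent (d : measure_display) (T : measurableType d)
    (R : realType) (P : probability T R) (I : eqType) (D : set I)
    (X : I -> {RV P >-> R}) : Prop :=
  forall (s : seq I) (A : I -> set R),
    uniq s -> {in s, forall i, D i} -> {in s, forall i, measurable (A i)} ->
    P [set w | forall i, i \in s -> A i (X i w)] =
    (\prod_(i <- s) P (X i @^-1` A i))%E.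

Definition iid_with_law (d : measure_display) (T : measurableType d)
    (R : realType) (P : probability T R) (I : eqType) (D : set I)
    (X : I -> {RV P >-> R}) (law : set R -> \bar R) : Prop :=
  mutually_independent D X /\
  forall i, D i -> forall A : set R, measurable A ->
    distribution P (X i) A = law A.

(* A configuration is encoded by the signs of its coordinates; its +1/-1
   coordinates are given by spin. *)
Definition config (N : nat) := {ffun 'I_N -> bool}.

Definition spin (R : realType) (N : nat) (s : config N) (i : 'I_N) : R :=
  (-1) ^+ s i.

(* A multi-index (i_1, ..., i_p) is the sequence [:: i_1; ...; i_p], so that the
   disorder of all the p-spin interactions is a single family indexed by
   seq 'I_N, of which only the indices of size at least 2 are used. *)
Definition multi_index (N : nat) : set (seq 'I_N) := [set i | (2 <= size i)%N].

Definition hamiltonian (R : realType) (N : nat) (beta : nat -> R) (h : R)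
    (J : seq 'I_N -> R) (s : config N) : R :=
  limn (fun n => \sum_(2 <= p < n)
    beta p / N%:R `^ ((p%:R - 1) / 2) *
    \sum_(i : p.-tuple 'I_N) J i * \prod_(k < p) spin R s (tnth i k))
  + h * \sum_(i < N) spin R s i.

Definition gibbs (R : realType) (N : nat) (beta : nat -> R) (h : R)
    (J : seq 'I_N -> R) (s : config N) : R :=
  expR (hamiltonian beta h J s) /
  \sum_(s' : config N) expR (hamiltonian beta h J s').

(* Expectation of L over n replicas, i.e. under the n-fold product of the Gibbs
   measure, at a fixed realization J of the disorder. *)
Definition replica_avg (R : realType) (N n : nat) (beta : nat -> R) (h : R)
    (J : seq 'I_N -> R) (L : {ffun 'I_n -> config N} -> R) : R :=
  \sum_(s : {ffun 'I_n -> config N}) L s * \prod_(l < n) gibbs beta h J (s l).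

Definition Ckm (k m : nat) : nat := (2 ^ (k * k.+1 %/ 2) * m ^ k)%N.

(* Main.v *)
Require Import Defs.
From HB Require Import structures.
From mathcomp Require Import all_boot all_order all_algebra.
From mathcomp Require Import all_classical all_reals all_analysis.
From mathcomp Require Import measurable_realfun ring lra.
Import numFieldNormedType.Exports.
Import Order.TTheory GRing.Theory Num.Theory.

Set Implicit Arguments.
Unset Strict Implicit.
Unset Printing Implicit Defensive.

Local Open Scope classical_set_scope.
Local Open Scope ring_scope.

(** The two averages are compared by Lindeberg's method. After truncation of the
    Hamiltonian at finite order, an average [E <L>] is the mean of a smooth bounded
    function of finitely many independent disorder variables, and the law of one
    variable at a time is changed from that of [y] to the Gaussian law
    ([lindeberg_replacement]). With all other variables held fixed, a single
    [J i] with [i] of size [p] multiplies the [+1/-1] quantity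
    [spin_prod s i], with coefficient [c_p = beta p / N ^ ((p - 1) / 2)]: the
    replica average, as a function of [x = J i], is an average on a finite set
    under weights proportional to [exp (a s + x u s)], where [|u| <= n c_p].
    Differentiating such a quotient gives again an average of the same kind,
    over pairs of points, for the observable [L s.1 * (u s.1 - u s.2)].
    Each differentiation doubles the bound on the tilt [u] and multiplies the
    bound on the observable by twice the current tilt, so that the [k]-th
    derivative is at most [2 ^ (k (k + 1) / 2) (n c_p) ^ k]
    ([normr_tilt_deriv], [gibbs_avg_taylor]).

    Taylor's formula then compares the means under the two laws, since matching
    moments cancel the Taylor polynomials ([Rintegral_match]). With two matching
    moments the cost is of order [c_p ^ 3 E|y|^3]. With four, the law of [y] may
    lack a fifth moment: the fifth-order remainder is used for [|y| < N^(1/4)],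
    where [|y|^5 <= N^(1/4) |y|^4], and the fourth-order one beyond. The Gaussian
    moments that enter are obtained by integration by parts.

    There are [N ^ p] variables of order [p], and the sum of the costs is governed by
    [N ^ p * c_p ^ k = beta p ^ k * N ^ (p - k (p - 1) / 2)]
    ([sum_coupling_pow_le]). The exponent is at most [-1/2] for [k = 3] and
    [p >= 4], at most [0] for [k = 4] and [p >= 2], and at most [-1/2] for [k = 5]
    and [p >= 2], of which the cut-off takes back [1/4]; this yields both bounds,
    uniformly in the order of truncation.

    It remains to remove the truncation. The layers of the Hamiltonian are sums
    of orthogonal variables, the [p]-th one having second moment
    [N * beta p ^ 2]; summability of [2 ^ p * beta p ^ 2] makes the series of
    layers converge absolutely almost surely ([ae_cvg_series]), and
    dominated convergence passes to the limit ([cvg_mean_truncated]). *)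

(** * Derivatives of tilted averages on a finite set *)

Definition tilt_avg (R : realType) (S : finType) (a u L : S -> R) (x : R) : R :=
  (\sum_s L s * expR (a s + x * u s)) / \sum_s expR (a s + x * u s).

(** The [k]-th derivative of [tilt_avg], as an average over [2 ^ k] copies of
    the base point. *)
Fixpoint tilt_deriv (R : realType) (k : nat) :
    forall S : finType, (S -> R) -> (S -> R) -> (S -> R) -> R -> R :=
  match k with
  | 0%N => fun S a u L => tilt_avg a u L
  | k'.+1 => fun S a u L =>
      @tilt_deriv R k' (S * S)%type (fun s => a s.1 + a s.2)
        (fun s => u s.1 + u s.2) (fun s => L s.1 * (u s.1 - u s.2))
  end.

Section tilted_averages.
Context {R : realType}.

Lemma sum_expR_gt0 (S : finType) (a : S -> R) : (0 < #|S|)%N ->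
  0 < \sum_s expR (a s).
Proof.
move=> /card_gt0P[s0 _]; rewrite (bigD1 s0)//= ltr_wpDr ?expR_gt0//.
by apply: sumr_ge0 => s _; exact: expR_ge0.
Qed.

Lemma is_derive_finsum (S : finType) (f : S -> R -> R) (df : S -> R) (x : R) :
  (forall s, is_derive x 1 (f s) (df s)) ->
  is_derive x 1 (fun x => \sum_s f s x) (\sum_s df s).
Proof.
move=> fdf; elim: (index_enum S) => [|s r IH].
  under eq_fun do rewrite big_nil; rewrite big_nil; exact: is_derive_cst.
by under eq_fun do rewrite big_cons; rewrite big_cons; exact: is_deriveD.
Qed.

Lemma is_derive_expR_affine (a u x : R) :
  is_derive x 1 (fun x => expR (a + x * u)) (u * expR (a + x * u)).
Proof.
have h : is_derive x 1 (fun x => a + x * u) u.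
  by apply: is_derive_eq; rewrite /GRing.scale /=; ring.
rewrite mulrC.
exact: (@is_derive1_comp R expR (fun x => a + x * u) x _ _ (is_derive_expR _) h).
Qed.

(** The quotient rule produces a difference of products of two sums over [S];
    expanded over pairs it is again an average, now of two replicas, in which
    the differentiated tilt enters through its increment. *)
Lemma is_derive_tilt_avg (S : finType) (a u L : S -> R) (x : R) :
  (0 < #|S|)%N ->
  is_derive x 1 (tilt_avg a u L)
    (tilt_avg (S := (S * S)%type) (fun s => a s.1 + a s.2)
        (fun s => u s.1 + u s.2) (fun s => L s.1 * (u s.1 - u s.2)) x).
Proof.
move=> S0.
have Zgt0 y : 0 < \sum_s expR (a s + y * u s) by exact: sum_expR_gt0.
have dN : is_derive x 1 (fun x => \sum_s L s * expR (a s + x * u s))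
    (\sum_s L s * (u s * expR (a s + x * u s))).
  apply: is_derive_finsum => s.
  have := is_derive_expR_affine (a s) (u s) x => h.
  exact: (@is_deriveZ _ _ _ _ (L s)).
have dZ : is_derive x 1 (fun x => \sum_s expR (a s + x * u s))
    (\sum_s (u s * expR (a s + x * u s))).
  by apply: is_derive_finsum => s; exact: is_derive_expR_affine.
have Z0 : \sum_s expR (a s + x * u s) != 0 by rewrite gt_eqF.
have dV := is_deriveV Z0 dZ.
rewrite /tilt_avg; apply: is_derive_eq.
rewrite /GRing.scale /=.
have -> : \sum_(s : S * S) expR (a s.1 + a s.2 + x * (u s.1 + u s.2)) =
    (\sum_s expR (a s + x * u s)) ^+ 2.
  rewrite expr2 big_distrlr /= pair_bigA /=; apply: eq_bigr => s _.
  by rewrite -expRD; congr expR; ring.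
have -> : \sum_(s : S * S) L s.1 * (u s.1 - u s.2) *
      expR (a s.1 + a s.2 + x * (u s.1 + u s.2)) =
    (\sum_s L s * (u s * expR (a s + x * u s))) * (\sum_s expR (a s + x * u s))
    - (\sum_s L s * expR (a s + x * u s)) *
      (\sum_s (u s * expR (a s + x * u s))).
  rewrite !big_distrlr /= !pair_bigA /= -sumrB; apply: eq_bigr => s _.
  rewrite (_ : a s.1 + _ + _ = (a s.1 + x * u s.1) + (a s.2 + x * u s.2));
    last by ring.
  by rewrite expRD; ring.
by field.
Qed.

Lemma is_derive_tilt_deriv k (S : finType) (a u L : S -> R) (x : R) :
  (0 < #|S|)%N ->
  is_derive x 1 (tilt_deriv k a u L) (tilt_deriv k.+1 a u L x).
Proof.
elim: k S a u L => [|k IH] S a u L S0; first exact: is_derive_tilt_avg.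
by apply: IH; rewrite card_prod muln_gt0 S0.
Qed.

Lemma normr_tilt_avg (S : finType) (a u L : S -> R) (B x : R) :
  (0 < #|S|)%N -> (forall s, `|L s| <= B) -> `|tilt_avg a u L x| <= B.
Proof.
move=> S0 LB; have Zgt0 := sum_expR_gt0 (fun s => a s + x * u s) S0.
rewrite /tilt_avg normrM normfV (gtr0_norm Zgt0) ler_pdivrMr// mulr_sumr.
apply: (le_trans (ler_norm_sum _ _ _)); apply: ler_sum => s _.
by rewrite normrM (ger0_norm (expR_ge0 _)) ler_wpM2r ?expR_ge0.
Qed.

(** Each differentiation doubles the tilt and multiplies the observable by at
    most twice the current tilt, so the powers of two accumulate to
    [0 + 1 + ... + k]. *)
Lemma normr_tilt_deriv k (S : finType) (a u L : S -> R) (U B x : R) :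
  (0 < #|S|)%N -> (forall s, `|u s| <= U) -> (forall s, `|L s| <= B) ->
  `|tilt_deriv k a u L x| <= 2 ^+ 'C(k.+1, 2) * U ^+ k * B.
Proof.
elim: k S a u L U B => [|k IH] S a u L U B S0 uU LB.
  by rewrite /= expr0 !mul1r; exact: normr_tilt_avg.
have S20 : (0 < #|((S * S)%type : finType)|)%N by rewrite card_prod muln_gt0 S0.
apply: (le_trans (IH _ _ _ _ (2 * U) (2 * U * B) S20 _ _)).
- move=> s; apply: (le_trans (ler_normD _ _)).
  by rewrite mulr_natl mulr2n lerD.
- move=> s; rewrite normrM mulrC ler_pM//.
  by apply: (le_trans (ler_normB _ _)); rewrite mulr_natl mulr2n lerD.
- rewrite [in leRHS]binS bin1 exprD exprMn !exprS.
  by rewrite le_eqVlt; apply/orP; left; apply/eqP; ring.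
Qed.

End tilted_averages.

Section taylor.
Context {R : realType}.

Lemma is_derive_monomial (c : R) n (y : R) :
  is_derive y 1 (fun y => c * y ^+ n) (c * (n%:R * y ^+ n.-1)).
Proof.
have h := @is_deriveX R R id n y 1 1 (is_derive_id _ _).
have := @is_deriveZ _ _ _ _ c _ _ _ h.
rewrite /GRing.scale /= mulr1 exprfctE.
exact: id.
Qed.

Lemma normr_le_of_deriv_monomial (f df : R -> R) (K : R) (m : nat) :
  (forall x : R, is_derive x 1 f (df x)) -> f 0 = 0 ->
  (forall x, `|df x| <= K * `|x| ^+ m) ->
  forall x, `|f x| <= K / m.+1%:R * `|x| ^+ m.+1.
Proof.
have main (g dg : R -> R) : (forall x : R, is_derive x 1 g (dg x)) -> g 0 = 0 ->
    (forall x, `|dg x| <= K * `|x| ^+ m) ->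
    forall x, 0 <= x -> g x <= K / m.+1%:R * x ^+ m.+1.
  move=> gdg g0 dgK x x0.
  pose h y := K / m.+1%:R * y ^+ m.+1 - g y.
  have hdh (y : R) : is_derive y 1 h (K * y ^+ m - dg y).
    have := is_deriveB (is_derive_monomial (K / m.+1%:R) m.+1 y) (gdg y).
    by rewrite mulrA divfK// pnatr_eq0.
  have ch : {within `[0, x], continuous h}.
    apply: continuous_subspaceT => y; apply: differentiable_continuous.
    by apply/derivable1_diffP; exact: ex_derive.
  have [c] := MVT_segment x0 (fun y _ => hdh y) ch.
  rewrite in_itv /= => /andP[c0 _].
  rewrite {1 2}/h g0 expr0n /= mulr0 !subr0 => hx.
  rewrite -subr_ge0 hx mulr_ge0// subr_ge0.
  by apply: (le_trans (ler_norm _)); rewrite -{2}(ger0_norm c0).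
have abs (g dg : R -> R) : (forall x : R, is_derive x 1 g (dg x)) -> g 0 = 0 ->
    (forall x, `|dg x| <= K * `|x| ^+ m) ->
    forall x, 0 <= x -> `|g x| <= K / m.+1%:R * x ^+ m.+1.
  move=> gdg g0 dgK x x0.
  rewrite ler_norml (main g dg)// andbT lerNl.
  apply: (main (fun y => - g y) (fun y => - dg y)) => //.
  - by rewrite g0 oppr0.
  - by move=> y; rewrite normrN.
move=> fdf f0 dfK x; have [x0|/ltW x0] := lerP 0 x.
  by rewrite (ger0_norm x0); exact: (abs f df).
have := abs (fun y => f (- y)) (fun y => - df (- y)) _ _ _ (- x).
rewrite opprK -(normrN x) (ger0_norm (x := - x)) ?oppr_ge0//; apply => //.
- move=> y; have := @is_derive1_comp R f -%R y (df (- y)) (-1) (fdf _).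
  by rewrite mulrN1; apply; exact: is_deriveNid.
- by rewrite oppr0.
- by move=> y; rewrite normrN (le_trans (dfK _))// normrN.
Qed.

(** Taylor's theorem with the coefficients read off a sequence of successive
    derivatives; one integrates the estimate for the shifted sequence. *)
Lemma taylor_le (f : nat -> R -> R) (m : nat) (M : R) :
  (forall k (x : R), is_derive x 1 (f k) (f k.+1 x)) ->
  (forall x, `|f m x| <= M) ->
  forall x, `|f 0%N x - \sum_(j < m) f j 0 / j`!%:R * x ^+ j|
            <= M / m`!%:R * `|x| ^+ m.
Proof.
elim: m f => [|m IH] f fdf fM x.
  by rewrite big_ord0 subr0 fact0 divr1 expr0 mulr1.
have {}IH := IH (fun k => f k.+1) (fun k => fdf k.+1) fM.
rewrite factS natrM.
have -> : M / (m.+1%:R * m`!%:R) = M / m`!%:R / m.+1%:R :> R.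
  by rewrite invfM mulrA mulrAC.
apply: (@normr_le_of_deriv_monomial
  (fun x => f 0%N x - \sum_(j < m.+1) f j 0 / j`!%:R * x ^+ j) _ _ _ _ _ IH).
- move=> y; apply: is_deriveB.
  under eq_fun do rewrite big_ord_recl /= expr0.
  rewrite -[X in is_derive _ _ _ X]add0r.
  apply: is_deriveD; apply: is_derive_finsum => j.
  have := is_derive_monomial (f (bump 0 j) 0 / (bump 0 j)`!%:R) (bump 0 j) y.
  rewrite /bump /= add1n factS natrM.
  congr (is_derive _ _ _ _); field.
  by rewrite nat1r !pnatr_eq0 -lt0n fact_gt0.
- rewrite big_ord_recl /= fact0 divr1 expr0 mulr1 big1 ?addr0 ?subrr// => j _.
  by rewrite expr0n /= mulr0.
Qed.

End taylor.

(** * Replacing independent variables one at a time *)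

Section bounded_integrals.
Context {R : realType} d (T : measurableType d) (P : probability T R).

Lemma bounded_integrable (f : T -> R) (C : R) :
  measurable_fun setT f -> (forall x, `|f x| <= C) ->
  P.-integrable setT (EFin \o f).
Proof.
move=> mf fC; apply: measurable_bounded_integrable => //.
  by apply: le_lt_trans (probability_le1 P measurableT) _; rewrite ltry.
rewrite /bounded_near; near=> M => x _ /=.
by apply: (le_trans (fC x)); near: M; apply: nbhs_pinfty_ge; exact: num_real.
Unshelve. all: by end_near. Qed.

Lemma normr_Rintegral_le (f : T -> R) (C : R) :
  measurable_fun setT f -> (forall x, `|f x| <= C) ->
  `|\int[P]_x f x| <= C.
Proof.
move=> mf fC; have fi := bounded_integrable mf fC.
apply: (le_trans (le_normr_Rintegral measurableT fi)).
have Ci : P.-integrable setT (EFin \o cst C).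
  by apply: (@bounded_integrable (cst C) `|C|).
have -> : C = \int[P]_x (cst C x).
  by rewrite Rintegral_cst// [X in fine X]probability_setT mulr1.
apply: le_Rintegral => //.
by apply: (@bounded_integrable _ C) => [|x]; [exact: measurableT_comp|
  rewrite normr_id].
Qed.

Lemma Rintegral_dist_le (f g : T -> R) (C e : R) :
  measurable_fun setT f -> measurable_fun setT g ->
  (forall x, `|f x| <= C) -> (forall x, `|g x| <= C) ->
  (forall x, `|f x - g x| <= e) ->
  `|\int[P]_x f x - \int[P]_x g x| <= e.
Proof.
move=> mf mg fC gC fge.
rewrite -RintegralB//; [|exact: (bounded_integrable mf fC)
  |exact: (bounded_integrable mg gC)].
by apply: normr_Rintegral_le => //; exact: measurable_realfun.measurable_funB.
Qed.

End bounded_integrals.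

Section sections.
Context {R : realType} d1 d2 (T1 : measurableType d1) (T2 : measurableType d2).
Variables (f : T1 * T2 -> R) (mf : measurable_fun setT f).

Lemma measurable_section1 x : measurable_fun setT (fun y => f (x, y)).
Proof. exact: measurableT_comp. Qed.

Lemma measurable_section2 y : measurable_fun setT (fun x => f (x, y)).
Proof. exact: measurableT_comp. Qed.

Lemma measurable_Rintegral_section (P2 : probability T2 R) (C : R) :
  (forall x, `|f x| <= C) ->
  measurable_fun setT (fun x => \int[P2]_y f (x, y)).
Proof.
move=> fC.
(* The integral over [T2] is a partial integral for a product measure; the Dirac
   mass supplies a first factor. *)
have fi : (\d_(point : T1) \x P2)%E.-integrable setT (EFin \o f).
  exact: (@bounded_integrable _ _ _ (\d_(point : T1) \x P2)%E f C).
have := measurableT_comp (fine_measurable measurableT) (measurable_fubini_F fi).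
exact.
Qed.

End sections.

Lemma EFin_bounded_Rintegral {R : realType} (C : R) d (T : measurableType d)
    (P : probability T R) (h : T -> R) :
  measurable_fun setT h -> (forall x, `|h x| <= C) ->
  (\int[P]_x h x)%:E = (\int[P]_x (h x)%:E)%E.
Proof.
move=> mh hC; rewrite /Rintegral fineK//; apply: integrable_fin_num => //.
exact: (bounded_integrable P mh hC).
Qed.

Lemma bounded_Fubini {R : realType} d1 d2 (T1 : measurableType d1)
    (T2 : measurableType d2) (P1 : probability T1 R) (P2 : probability T2 R)
    (f : T1 * T2 -> R) (C : R) :
  measurable_fun setT f -> (forall x, `|f x| <= C) ->
  \int[P1]_x \int[P2]_y f (x, y) = \int[P2]_y \int[P1]_x f (x, y).
Proof.
move=> mf fC.
have fi : (P1 \x P2)%E.-integrable setT (EFin \o f).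
  exact: (@bounded_integrable _ _ _ (P1 \x P2)%E f C).
rewrite /Rintegral; congr fine; transitivity (\int[P1]_x \int[P2]_y (f (x, y))%:E)%E.
  apply: eq_integral => x _.
  rewrite -(@EFin_bounded_Rintegral _ C)// => ?; exact: measurable_section1.
rewrite (Fubini fi); apply: eq_integral => y _.
rewrite -(@EFin_bounded_Rintegral _ C)//; exact: measurable_section2.
Qed.

Section independence.
Context {R : realType} d dZ dX (T : measurableType d) (TZ : measurableType dZ)
  (TX : measurableType dX) (P : probability T R).
Variables (Z : {RV P >-> TZ}) (X : {RV P >-> TX}).
Hypothesis indep : forall A B, measurable A -> measurable B ->
  P (Z @^-1` A `&` X @^-1` B) = (P (Z @^-1` A) * P (X @^-1` B))%E.

Let mZX : measurable_fun setT (fun w => (Z w, X w)).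
Proof. exact: measurable_fun_pair. Qed.

Let ZX : {RV P >-> (TZ * TX)%type} := mfun_Sub (mem_set mZX).

Let lawZX A : measurable A ->
  distribution P ZX A = (distribution P Z \x distribution P X)%E A.
Proof.
by move=> mA; apply/esym; apply: product_measure_unique.
Qed.

(** Independence identifies the joint law with the product of the marginals, so
    this is Tonelli's theorem. *)
Lemma ge0_integral_indep (f : TZ * TX -> \bar R) :
  measurable_fun setT f -> (forall x, 0 <= f x)%E ->
  (\int[P]_w f (Z w, X w) = \int[P]_w \int[distribution P X]_x f (Z w, x))%E.
Proof.
move=> mf f0.
rewrite -(@ge0_integral_distribution _ _ _ _ _ P ZX f)//.
rewrite (eq_measure_integral _ (fun A mA _ => lawZX mA)).
rewrite fubini_tonelli1//= ge0_integral_distribution//.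
- exact: (@measurable_fun_fubini_tonelli_F _ _ _ _ _ _ f).
- by move=> z; apply: integral_ge0.
Qed.

Lemma integral_indep (f : TZ * TX -> \bar R) :
  measurable_fun setT f ->
  (\int[P]_w \int[distribution P X]_x `|f (Z w, x)| < +oo)%E ->
  (\int[P]_w f (Z w, X w) = \int[P]_w \int[distribution P X]_x f (Z w, x))%E.
Proof.
move=> mf foo.
have mabs : measurable_fun setT (fun x => `|f x|%E) by exact: measurableT_comp.
have fZX : P.-integrable setT (f \o ZX).
  apply/integrableP; split; first exact: measurableT_comp.
  by rewrite (ge0_integral_indep mabs).
rewrite -(@integral_distribution _ _ _ _ _ P ZX f)//.
rewrite (eq_measure_integral _ (fun A mA _ => lawZX mA)).
have fi : (distribution P Z \x distribution P X)%E.-integrable setT f.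
  apply/integrable12ltyP => //.
  rewrite ge0_integral_distribution//.
  - exact: (measurable_fun_fubini_tonelli_F _ mabs).
  - by move=> z; apply: integral_ge0.
rewrite -integral12_prod_meas1// integral_distribution//.
  exact: (measurable_fubini_F fi).
have mF := measurable_fubini_F fi.
have /integrableP[_] := integrable_fubini_F fi.
rewrite ge0_integral_distribution//; last exact: measurableT_comp.
by move=> h; apply/integrableP; split => //; exact: measurableT_comp.
Qed.

End independence.

Lemma Rintegral_indep {R : realType} d dZ dX (T : measurableType d)
    (TZ : measurableType dZ) (TX : measurableType dX) (P : probability T R)
    (Z : {RV P >-> TZ}) (X : {RV P >-> TX}) (f : TZ * TX -> R) (C : R) :
  (forall A B, measurable A -> measurable B ->
    P (Z @^-1` A `&` X @^-1` B) = (P (Z @^-1` A) * P (X @^-1` B))%E) ->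
  measurable_fun setT f -> (forall x, `|f x| <= C) ->
  \int[P]_w f (Z w, X w) = \int[P]_w \int[distribution P X]_x f (Z w, x).
Proof.
move=> indep mf fC; rewrite /Rintegral; congr fine.
rewrite (integral_indep indep (f := EFin \o f)).
- apply: eq_integral => w _; rewrite -(@EFin_bounded_Rintegral _ C)//.
  exact: measurable_section1.
- exact/measurable_EFinP.
- apply: (@le_lt_trans _ _ (\int[P]_w C%:E)%E); last first.
    by rewrite integral_cst// [X in (_ * X)%E]probability_setT mule1 ltry.
  apply: ge0_le_integral => //.
  + by move=> w _; apply: integral_ge0.
  + have mabs : measurable_fun setT (fun x => `|(f x)%:E|%E).
      by apply: measurableT_comp => //; exact/measurable_EFinP.
    have := @measurable_fun_fubini_tonelli_F _ _ _ _ _ (distribution P X) _ mabs.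
    move=> /(_ (fun=> abse_ge0 _)) mF.
    exact: (measurableT_comp mF).
  + move=> w _; apply: (@le_trans _ _ (\int[distribution P X]_x C%:E)%E).
      apply: ge0_le_integral => //.
      * apply: measurableT_comp => //; apply/measurable_EFinP.
        exact: measurable_section1.
      * by move=> x _; rewrite lee_fin.
    by rewrite integral_cst// [X in (_ * X)%E]probability_setT mule1.
Qed.

(** Measurability of a functional of a family of reals indexed by an arbitrary
    type, phrased through measurable families of coordinates so as to avoid a
    product sigma-algebra on [I -> R]. *)
Definition coord_measurable (R : realType) (I : Type) (F : (I -> R) -> R) :=
  forall d (T : measurableType d) (J : T -> I -> R),
    (forall i, measurable_fun setT (fun t => J t i)) ->
    measurable_fun setT (fun t => F (J t)).

Section independent_family.
Context {R : realType} d (T : measurableType d) (P : probability T R).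
Context (I : eqType) (X : I -> {RV P >-> R}).

(** The pi-system generating the sigma-algebra of the variables [X j],
    [j \in s]; being stable under intersection, it is where the product rule
    for rectangles is available. *)
Definition rectangles (s : seq I) : set (set T) :=
  [set B | exists A : I -> set R, (forall j, measurable (A j)) /\
                                  B = [set w | forall j, j \in s -> A j (X j w)]].

Local Notation cylinder s := (g_sigma_algebraType (rectangles s)).

Lemma measurable_rectangles s B : rectangles s B -> measurable B.
Proof.
move=> [A [mA ->]].
rewrite [X in measurable X](_ : _ = \bigcap_(j in [set` s]) (X j @^-1` A j)).
  apply: fin_bigcap_measurable; first exact: finite_seq.
  by move=> j _; rewrite -[X in measurable X]setTI; exact: measurable_funP.
by apply/seteqP; split.
Qed.

Lemma measurable_cylinder s (B : set (cylinder s)) :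
  measurable B -> measurable (B : set T).
Proof.
apply: smallest_sub; first exact: sigma_algebra_measurable.
exact: measurable_rectangles.
Qed.

Lemma measurable_coord_cylinder s j : j \in s ->
  measurable_fun [set: cylinder s] (fun w : cylinder s => X j w).
Proof.
move=> js _ A mA; rewrite setTI; apply: sub_sigma_algebra.
exists (fun i => if i == j then A else setT); split.
  by move=> i; case: ifP.
apply/seteqP; split => [w /= Aw i _|w /= /(_ j js)].
  by case: eqP => // ->.
by rewrite eqxx.
Qed.

Lemma rectangles_setI s : setI_closed (rectangles s).
Proof.
move=> _ _ [A [mA ->]] [A' [mA' ->]].
exists (fun j => A j `&` A' j); split; first by move=> j; exact: measurableI.
apply/seteqP; split => [w /= [Aw A'w] j js|w /= AA'w].
  by split; [exact: Aw|exact: A'w].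
by split => j js; case: (AA'w j js).
Qed.

Variable D : set I.
Hypothesis indep : mutually_independent D X.
Variables (k : I) (s : seq I).
Hypothesis ks : uniq (k :: s).
Hypothesis ksD : {in k :: s, forall i, D i}.

(** The events satisfying the product rule with [X k] form a Dynkin class that
    contains the rectangles. *)
Lemma cylinder_indep (B : set (cylinder s)) (A : set R) :
  measurable B -> measurable A ->
  P ((B : set T) `&` X k @^-1` A) = (P (B : set T) * P (X k @^-1` A))%E.
Proof.
move=> mB mA.
have mXA : measurable (X k @^-1` A).
  by rewrite -[X in measurable X]setTI; exact: measurable_funP.
have finX : P (X k @^-1` A) \is a fin_num by exact: fin_num_measure.
move: B mB.
apply: (@dynkin_induction _ (cylinder s) (rectangles s)
  (fun B => P ((B : set T) `&` X k @^-1` A) =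
            (P (B : set T) * P (X k @^-1` A))%E)) => //.
- exact: rectangles_setI.
- by rewrite setTI [P setT]probability_setT mul1e.
- move=> B [A' [mA' ->]].
  have [kns us] : k \notin s /\ uniq s by move: ks => /= /andP[].
  have := indep (s := k :: s) (A := fun i => if i == k then A else A' i) ks ksD.
  rewrite big_cons eqxx.
  rewrite (_ : [set w | _] = [set w | forall j, j \in s -> A' j (X j w)] `&`
      X k @^-1` A); last first.
    apply/seteqP; split => [w /= Aw|w /= [A'w Aw] i].
      split; last by have := Aw k (mem_head _ _); rewrite eqxx.
      move=> j js; have := Aw j; rewrite inE js orbT => /(_ isT).
      by case: eqP => // jk; move: kns; rewrite -jk js.
    by rewrite inE; case: eqP => [-> _ //|_ /= is_]; exact: A'w.
  move=> ->; last by move=> i _; case: ifP.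
  have := indep (s := s) (A := A') us.
  move=> -> //; last by move=> i is_; apply: ksD; rewrite inE is_ orbT.
  rewrite muleC; congr (_ * _)%E; apply: eq_big_seq => j js.
  by case: eqP => // jk; move: kns; rewrite -jk js.
- move=> S /measurable_cylinder mS SE.
  rewrite (_ : _ `&` _ = (X k @^-1` A) `\` (S : set T)); last first.
    by apply/seteqP; split => w /= [].
  rewrite measureD//; last by rewrite ltey_eq finX.
  rewrite (_ : X k @^-1` A `&` S = S `&` X k @^-1` A) ?SE; last first.
    by apply/seteqP; split => w /= [].
  rewrite probability_setC// muleBl ?mul1e//.
  by congr (_ - _)%E; exact: SE.
- move=> F mF tF FE.
  have mF' n : measurable (F n : set T) by exact: measurable_cylinder (mF n).
  rewrite setI_bigcupl !measure_bigcup//; last 2 first.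
  + by move=> i _; exact: measurableI.
  + by apply: trivIset_setIr; exact: tF.
  rewrite -(fineK finX) muleC -nneseriesZl//.
  by apply: eq_eseriesr => i _; rewrite muleC (fineK finX); exact: FE.
Qed.

(** The coordinates in [s] generate a sigma-algebra independent of [X k], so that
    [X k] may be integrated first, against its own law. *)
Lemma Rintegral_peel (F : (I -> R) -> R) (C : R) (c : I -> R) :
  coord_measurable F -> (forall J, `|F J| <= C) ->
  \int[P]_w F (fun j => if j \in k :: s then X j w else c j) =
  \int[P]_w \int[distribution P (X k)]_x
    F (fun j => if j == k then x else if j \in s then X j w else c j).
Proof.
move=> mF FC.
(* All the coordinates in [s] together are encoded by the identity of [T],
   with values in the sigma-algebra that they generate. *)
have mid : measurable_fun setT (id : T -> cylinder s).
  by move=> _ B /measurable_cylinder mB; rewrite setTI.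
pose Z : {RV P >-> cylinder s} := mfun_Sub (mem_set mid).
pose f (p : cylinder s * R) : R :=
  F (fun j => if j == k then p.2 else if j \in s then X j p.1 else c j).
rewrite -(@Rintegral_indep _ _ _ _ _ _ _ P Z (X k) f C).
- apply: eq_Rintegral => w _; rewrite /f; congr F; apply/funext => j /=.
  by rewrite inE; case: eqP => // ->.
- by move=> B A mB mA; exact: cylinder_indep.
- apply: mF => j; case: eqP => _; first exact: measurable_snd.
  case: (boolP (j \in s)) => js; last exact: measurable_cst.
  exact: (measurableT_comp (measurable_coord_cylinder js) measurable_fst).
- by move=> p; exact: FC.
Qed.

End independent_family.

Section lindeberg.
Context {R : realType} d1 d2 (T1 : measurableType d1) (T2 : measurableType d2).
Variables (P1 : probability T1 R) (P2 : probability T2 R) (I : eqType).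
Variables (X1 : I -> {RV P1 >-> R}) (X2 : I -> {RV P2 >-> R}) (D : set I).
Hypotheses (indep1 : mutually_independent D X1)
           (indep2 : mutually_independent D X2).
Variables (F : (I -> R) -> R) (C : R) (eps : I -> R) (s : seq I).
Hypotheses (mF : coord_measurable F) (FC : forall J, `|F J| <= C).
Hypotheses (us : uniq s) (sD : {in s, forall i, D i}).
Hypothesis Feps : forall i J, i \in s ->
  `|\int[distribution P2 (X2 i)]_x F (fun j => if j == i then x else J j)
    - \int[distribution P1 (X1 i)]_x F (fun j => if j == i then x else J j)|
  <= eps i.

Let hybrid (s1 s2 : seq I) (w : T1 * T2) (j : I) : R :=
  if j \in s1 then X1 j w.1 else if j \in s2 then X2 j w.2 else 0.

Let mhybrid s1 s2 j : measurable_fun setT (fun w => hybrid s1 s2 w j).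
Proof.
rewrite /hybrid; case: (j \in s1); first exact: measurableT_comp.
by case: (j \in s2); [exact: measurableT_comp|exact: measurable_cst].
Qed.

Let mean_hybrid s1 s2 := \int[P1]_w1 \int[P2]_w2 F (hybrid s1 s2 (w1, w2)).

Let line k s1 s2 (w : T1 * T2) (x : R) :=
  F (fun j => if j == k then x else hybrid s1 s2 w j).

Let mline k s1 s2 : measurable_fun setT
  (fun p : T1 * T2 * R => line k s1 s2 p.1 p.2).
Proof.
apply: mF => j; case: eqP => _; first exact: measurable_snd.
exact: (measurableT_comp (mhybrid s1 s2 j) measurable_fst).
Qed.

Let swap_step k s1 s2 : uniq (s1 ++ k :: s2) ->
  {in s1 ++ k :: s2, forall i, i \in s} ->
  `|mean_hybrid s1 (k :: s2) - mean_hybrid (k :: s1) s2| <= eps k.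
Proof.
rewrite cat_uniq => /and3P[us1 s1k2 uk2] ss.
have ks : k \in s by apply: ss; rewrite mem_cat mem_head orbT.
have kns1 : k \notin s1.
  by apply/negP => ks1; move/hasPn : s1k2 => /(_ k (mem_head _ _)); rewrite /= ks1.
have s1s2 j : j \in s1 -> j \notin s2.
  move=> js1; apply/negP => js2; move/hasPn : s1k2 => /(_ j).
  by rewrite inE js2 orbT /= js1 => /(_ isT).
have E2 : mean_hybrid s1 (k :: s2) = \int[P1]_w1 \int[P2]_w2
    \int[distribution P2 (X2 k)]_x line k s1 s2 (w1, w2) x.
  apply: eq_Rintegral => w1 _.
  have sD2 : {in k :: s2, forall i, D i}.
    by move=> i ik; apply/sD/ss; rewrite mem_cat ik orbT.
  have := Rintegral_peel indep2 uk2 sD2 (fun j => if j \in s1 then X1 j w1 else 0)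
    mF FC.
  move=> peel; transitivity (\int[P2]_w F (fun j => if j \in k :: s2 then X2 j w
      else if j \in s1 then X1 j w1 else 0)).
    apply: eq_Rintegral => w2 _; congr F; apply/funext => j; rewrite /hybrid /=.
    rewrite inE; case: ifPn => js1 //; case: eqP => [jk|_ /=].
      by move: kns1; rewrite -jk js1.
    by rewrite (negbTE (s1s2 _ js1)).
  rewrite peel; apply: eq_Rintegral => w2 _; apply: eq_Rintegral => x _.
  congr F; apply/funext => j; rewrite /hybrid /=; case: eqP => // _.
  by case: (boolP (j \in s1)) => // js1; rewrite (negbTE (s1s2 _ js1)).
have mhyb s1' s2' : measurable_fun setT (fun w => F (hybrid s1' s2' w)).
  exact: mF.
have minner (mu : probability R R) :
    measurable_fun setT (fun w => \int[mu]_x line k s1 s2 w x).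
  exact: (measurable_Rintegral_section (mline k s1 s2) mu (fun p => FC _)).
have minnerC (mu : probability R R) w :
    `|\int[mu]_x line k s1 s2 w x| <= C.
  apply: normr_Rintegral_le => [|x]; last exact: FC.
  exact: (measurable_section1 (mline k s1 s2)).
have E1 : mean_hybrid (k :: s1) s2 = \int[P1]_w1 \int[P2]_w2
    \int[distribution P1 (X1 k)]_x line k s1 s2 (w1, w2) x.
  (* The coordinate to be integrated lives on [T1], hence the exchange of the
     integrals before and after. *)
  rewrite /mean_hybrid (bounded_Fubini _ _ (mhyb _ _) (fun w => FC _)).
  rewrite (bounded_Fubini _ _ (minner _) (minnerC _)).
  apply: eq_Rintegral => w2 _.
  have uk1 : uniq (k :: s1) by rewrite /= kns1.
  have sD1 : {in k :: s1, forall i, D i}.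
    move=> i ik; apply/sD/ss; move: ik; rewrite mem_cat !inE.
    by case/orP => ->; rewrite ?orbT.
  have := Rintegral_peel indep1 uk1 sD1 (fun j => if j \in s2 then X2 j w2 else 0)
    mF FC.
  exact.
rewrite E1 E2; apply: (@Rintegral_dist_le _ _ _ _ _ _ C) => [|||w1|w1].
- exact: (measurable_Rintegral_section (minner _) P2 (minnerC _)).
- exact: (measurable_Rintegral_section (minner _) P2 (minnerC _)).
- move=> w1; apply: normr_Rintegral_le => [|w2]; last exact: minnerC.
  exact: (measurable_section1 (minner _)).
- apply: normr_Rintegral_le => [|w2]; last exact: minnerC.
  exact: (measurable_section1 (minner _)).
- apply: (@Rintegral_dist_le _ _ _ _ _ _ C) => [|||w2|w2].
  + exact: (measurable_section1 (minner _)).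
  + exact: (measurable_section1 (minner _)).
  + by move=> w2; exact: minnerC.
  + exact: minnerC.
  + exact: Feps.
Qed.

Let swap_all s1 s2 : uniq (s1 ++ s2) -> {in s1 ++ s2, forall i, i \in s} ->
  `|mean_hybrid s1 s2 - mean_hybrid (catrev s2 s1) [::]| <= \sum_(i <- s2) eps i.
Proof.
elim: s2 s1 => [|k s2 IH] s1 us12 ss.
  by rewrite big_nil subrr normr0.
rewrite big_cons -(subrKA (mean_hybrid (k :: s1) s2)).
have pcat : perm_eq (s1 ++ k :: s2) ((k :: s1) ++ s2).
  by rewrite -cat1s perm_catCA.
apply: (le_trans (ler_normD _ _)); apply: lerD; first exact: swap_step.
apply: IH; first by rewrite -(perm_uniq pcat).
by move=> i; rewrite -(perm_mem pcat); exact: ss.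
Qed.

(** The means of [F] along the successive hybrids of the two families telescope.
    Two consecutive hybrids differ in one coordinate, which by independence can be
    integrated against its law with the others held fixed. *)
Theorem lindeberg_replacement :
  `|\int[P2]_w F (fun j => if j \in s then X2 j w else 0)
    - \int[P1]_w F (fun j => if j \in s then X1 j w else 0)|
  <= \sum_(i <- s) eps i.
Proof.
have := @swap_all [::] s us (fun i is_ => is_).
congr (`|_ - _| <= _).
- rewrite /mean_hybrid /hybrid /= Rintegral_cst//.
  by rewrite [X in fine X]probability_setT mulr1.
- apply: eq_Rintegral => w1 _; rewrite /hybrid.
  under eq_Rintegral do under eq_fun do rewrite /= catrevE cats0 mem_rev.
  by rewrite Rintegral_cst// [X in fine X]probability_setT mulr1.
Qed.

End lindeberg.

(** * Moments of the standard Gaussian law *)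

Section gaussian_moments.
Context {R : realType}.
Local Notation mu := (@lebesgue_measure R).
Local Notation gauss := (normal_prob (0 : R) 1).
Local Notation pdf := (normal_pdf (0 : R) 1).

Lemma normal_pdf01E x :
  pdf x = normal_peak (1 : R) * expR (- (x ^+ 2 / 2)).
Proof.
by rewrite /normal_pdf (negbTE (oner_neq0 _)) /normal_fun subr0 expr1n mulNr.
Qed.

(** The change of variables holds for the Radon-Nikodym derivative, which
    agrees almost everywhere with the density that defines the law. *)
Lemma ge0_integral_gauss (E : set R) (f : R -> \bar R) :
  measurable E -> measurable_fun E f -> (forall x, 0 <= f x)%E ->
  (\int[gauss]_(x in E) f x = \int[mu]_(x in E) (f x * (pdf x)%:E))%E.
Proof.
move=> mE mf f0.
have dom : gauss `<< mu by exact: normal_prob_dominates.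
rewrite -(Radon_Nikodym_SigmaFinite.change_of_variables dom f0 mE mf).
have mpdf : measurable_fun setT (EFin \o pdf).
  by apply/measurable_EFinP; exact: measurable_normal_pdf.
have RNi := Radon_Nikodym_SigmaFinite.f_integrable dom.
apply: ae_eq_integral => //.
- apply: emeasurable_funM => //; apply: (@measurable_funTS _ _ _ _ E).
  exact: (measurable_int _ RNi).
- by apply: emeasurable_funM => //; exact: (measurable_funTS mpdf).
- apply: ae_eqe_mul2l; apply: integral_ae_eq => //.
  + by apply: (integrableS _ _ (@subsetT _ _) RNi).
  + exact: measurable_funTS.
  + move=> A AE mA.
    by rewrite -(Radon_Nikodym_SigmaFinite.f_integral dom mA).
Qed.

Lemma ge0_integral_gaussN (f : R -> \bar R) :
  measurable_fun setT f -> (forall x, 0 <= f x)%E ->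
  (\int[gauss]_x f (- x)%R = \int[gauss]_x f x)%E.
Proof.
move=> mf f0.
have mN : measurable_fun setT (-%R : R -> R) by exact: oppr_measurable.
have mpdf : measurable_fun setT (EFin \o pdf).
  by apply/measurable_EFinP; exact: measurable_normal_pdf.
have mfp : measurable_fun setT (fun x => f x * (pdf x)%:E)%E.
  by apply: emeasurable_funM.
rewrite !ge0_integral_gauss//; last exact: measurableT_comp.
transitivity (\int[mu]_x ((fun x => f x * (pdf x)%:E) \o -%R) x)%E.
  by apply: eq_integral => x _ /=; rewrite !normal_pdf01E sqrrN.
rewrite -[X in integral _ X _](preimage_setT (-%R : _ -> measurableTypeR R)).
rewrite -ge0_integral_pushforward//=.
- by apply: eq_measure_integral => //= A mA _; exact: lebesgue_measureN.
- by move=> x _; rewrite mule_ge0// lee_fin normal_pdf_ge0.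
Qed.

(** Integration by parts, from [pdf' x = - x * pdf x]. For even [k] the boundary
    terms at the two ends add up. *)
Lemma gauss_moment_itv (k : nat) (M : R) : 0 < M -> ~~ odd k ->
  (\int[gauss]_(x in `[(- M)%R, M]) (x ^+ k.+2)%:E =
   k.+1%:R%:E * \int[gauss]_(x in `[(- M)%R, M]) (x ^+ k)%:E
   - (2 * (M ^+ k.+1 * pdf M))%:E)%E.
Proof.
move=> M0 ek.
have pdf_deriv (x : R) : is_derive x 1 pdf (- x * pdf x).
  have -> : pdf = (fun x => normal_peak 1 * expR (0 + (- (x ^+ 2 / 2)))).
    by apply/funext => y; rewrite add0r normal_pdf01E.
  have d2 := is_derive_monomial (- 2^-1 : R) 2 x.
  have d2' : is_derive x 1 (fun x : R => 0 + - (x ^+ 2 / 2)) (- x).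
    have -> : (fun x : R => 0 + - (x ^+ 2 / 2)) = (fun y => - 2^-1 * y ^+ 2).
      by apply/funext => y; rewrite add0r mulNr mulrC.
    by apply: (is_derive_eq d2); rewrite /= expr1; field.
  have de := @is_derive1_comp R expR _ x _ _ (is_derive_expR _) d2'.
  have := @is_deriveZ _ _ _ _ (normal_peak 1) _ _ _ de.
  rewrite /GRing.scale /= => h; apply: (is_derive_eq h).
  by ring.
pose f (x : R) := x ^+ k.+2 * pdf x - k.+1%:R * (x ^+ k * pdf x).
pose H (x : R) := - (x ^+ k.+1 * pdf x).
have dH (x : R) : is_derive x 1 H (f x).
  have d1 := is_derive_monomial (1 : R) k.+1 x.
  have d1' : is_derive x 1 (fun x : R => x ^+ k.+1) (k.+1%:R * x ^+ k).
    have -> : (fun x : R => x ^+ k.+1) = (fun y => 1 * y ^+ k.+1).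
      by apply/funext => y; rewrite mul1r.
    by apply: (is_derive_eq d1); rewrite mul1r.
  have := is_deriveN (is_deriveM d1' (pdf_deriv x)).
  move=> h; apply: (is_derive_eq h); rewrite /f /GRing.scale /= !exprS.
  by ring.
have cpdf : continuous pdf by apply: continuous_normal_pdf; exact: oner_neq0.
have cmon j : continuous (fun x : R => x ^+ j * pdf x).
  by move=> x; apply: cvgM; [exact: exprn_continuous|exact: cpdf].
have cf : continuous f.
  by move=> x; apply: cvgB; [exact: cmon|apply: cvgM; [exact: cvg_cst|exact: cmon]].
have NMM : - M < M by rewrite (lt_trans _ M0)// oppr_lt0.
have cH : continuous H.
  by move=> x; apply: cvgN; exact: cmon.
have := @continuous_FTC2 R f H (- M) M NMM (continuous_subspaceT cf).
have pdfN : pdf (- M) = pdf M by rewrite !normal_pdf01E sqrrN.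
have -> : (H M)%:E = (- (M ^+ k.+1 * pdf M))%:E by [].
have -> : (H (- M))%:E = (M ^+ k.+1 * pdf M)%:E.
  by rewrite /H pdfN exprNn -signr_odd /= (negbTE ek) /= expr1 mulN1r mulNr opprK.
move=> ftc.
have icmp j : mu.-integrable `[- M, M] (fun x => (x ^+ j * pdf x)%:E).
  apply: (@continuous_compact_integrable _ (fun x => x ^+ j * pdf x)).
    exact: segment_compact.
  exact: (continuous_subspaceT (@cmon j)).
have gE j : ~~ odd j -> (\int[gauss]_(x in `[(- M)%R, M]) (x ^+ j)%:E =
    \int[mu]_(x in `[(- M)%R, M]) (x ^+ j * pdf x)%:E)%E.
  move=> ej; rewrite ge0_integral_gauss//.
  - apply/measurable_EFinP; exact: measurable_funX.
  - by move=> x; rewrite lee_fin exprn_even_ge0.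
have ek2 : ~~ odd k.+2 by rewrite /= negbK.
rewrite !gE//.
have : (\int[mu]_(x in `[(- M)%R, M]) (f x)%:E =
   \int[mu]_(x in `[(- M)%R, M]) (x ^+ k.+2 * pdf x)%:E
   - k.+1%:R%:E * \int[mu]_(x in `[(- M)%R, M]) (x ^+ k * pdf x)%:E)%E.
  rewrite -integralZl// -integralB//; exact: integrableZl.
rewrite ftc; last 2 first.
- split.
  + by move=> x _; apply: ex_derive; exact: dH.
  + exact: cvg_at_right_filter (cH _).
  + exact: cvg_at_left_filter (cH _).
- by move=> x _; rewrite derive1E; exact: (@derive_val _ _ _ _ _ _ _ (dH x)).
have := integrable_fin_num _ (icmp k.+2).
have := integrable_fin_num _ (icmp k).
move=> /(_ (measurable_itv _)) /fineK <- /(_ (measurable_itv _)) /fineK <-.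
rewrite -!EFinM -!EFinB => -[h]; congr EFin; lra.
Qed.

Lemma gauss_moment_cvg (k : nat) : ~~ odd k ->
  (\int[gauss]_(x in `[(- i.+1%:R)%R, i.+1%:R]) (x ^+ k)%:E @[i --> \oo] -->
   \int[gauss]_x (x ^+ k)%:E)%E.
Proof.
move=> ek.
have -> : [set: R] = \bigcup_i `[- i.+1%:R, i.+1%:R]%classic.
  apply/seteqP; split => // x _.
  exists (Num.truncn `|x|) => //=; rewrite in_itv /= -ler_norml.
  by rewrite ltW// truncnS_gt.
apply: ge0_nondecreasing_set_cvg_integral.
- move=> m n mn; apply/subsetPset => x /=; rewrite !in_itv /= -!ler_norml.
  by move=> /le_trans; apply; rewrite ler_nat.
- by [].
- by move=> i; apply/measurable_EFinP; exact: measurable_funX.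
- by move=> i x _; rewrite lee_fin exprn_even_ge0.
Qed.

Lemma gauss_moment_itv_le (k : nat) (E : set R) : measurable E -> ~~ odd k ->
  (\int[gauss]_(x in E) (x ^+ k)%:E <= \int[gauss]_x (x ^+ k)%:E)%E.
Proof.
move=> mE ek; apply: ge0_subset_integral => //.
- by apply/measurable_EFinP; exact: measurable_funX.
- by move=> x _; rewrite lee_fin exprn_even_ge0.
Qed.

(** In the integration by parts on an interval, the boundary term is
    subtracted. *)
Lemma gauss_moment_le (k : nat) : ~~ odd k ->
  (\int[gauss]_x (x ^+ k.+2)%:E <= k.+1%:R%:E * \int[gauss]_x (x ^+ k)%:E)%E.
Proof.
move=> ek; have ek2 : ~~ odd k.+2 by rewrite /= negbK.
have := gauss_moment_cvg ek2 => /cvg_lim <- //.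
apply: lime_le; first by apply/cvg_ex; eexists; exact: gauss_moment_cvg.
apply: nearW => i; rewrite gauss_moment_itv//.
apply: (@le_trans _ _ (k.+1%:R%:E *
   \int[gauss]_(x in `[(- i.+1%:R)%R, i.+1%:R]) (x ^+ k)%:E)%E).
  rewrite leeBlDr// leeDl// lee_fin mulr_ge0// mulr_ge0 ?exprn_ge0//.
  exact: normal_pdf_ge0.
by apply: lee_wpmul2l => //; exact: gauss_moment_itv_le.
Qed.

Lemma gauss_moment0 : (\int[gauss]_x (x ^+ 0)%:E = 1)%E.
Proof.
under eq_integral do rewrite expr0.
by rewrite integral_cst// mul1e [LHS]probability_setT.
Qed.

(** The boundary term of the integration by parts is at most a constant over
    the length of the interval, since [exp (- x) <= 1 / (1 + x)]. *)
Lemma gauss_moment2 : (\int[gauss]_x (x ^+ 2)%:E = 1)%E.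
Proof.
apply/eqP; rewrite eq_le; apply/andP; split.
  by have := @gauss_moment_le 0 isT; rewrite gauss_moment0 mule1.
have := @gauss_moment_cvg 0 isT; rewrite gauss_moment0 => c0.
pose c := 4 * normal_peak (1 : R).
have cb : ((c / i.+1%:R)%:E @[i --> \oo] --> (0 : \bar R))%E.
  apply: cvg_EFin; first exact: nearW.
  rewrite -[X in _ --> X](mulr0 c); apply: cvgM; first exact: cvg_cst.
  exact: cvg_harmonic.
have c1 : (\int[gauss]_(x in `[(- i.+1%:R)%R, i.+1%:R]) (x ^+ 0)%:E
    - (c / i.+1%:R)%:E @[i --> \oo] --> (1 : \bar R))%E.
  by rewrite -[X in _ --> X]sube0; apply: cvgeB.
rewrite -(cvg_lim _ c1)//; apply: lime_le; first by apply/cvg_ex; eexists; exact: c1.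
apply: nearW => i.
apply: le_trans (gauss_moment_itv_le (measurable_itv `[- i.+1%:R, i.+1%:R])
  (isT : ~~ odd 2)).
rewrite gauss_moment_itv// mul1e; apply: leeB => //; rewrite lee_fin.
rewrite /c expr1 normal_pdf01E.
have i0 : 0 < i.+1%:R :> R by [].
have e1 : expR (- (i.+1%:R ^+ 2 / 2)) <= 2 / i.+1%:R ^+ 2 :> R.
  rewrite expRN -[leRHS]invrK lef_pV2 ?posrE ?expR_gt0 ?invr_gt0 ?divr_gt0 ?exprn_gt0//.
  rewrite invf_div; apply: le_trans (expR_ge1Dx _).
  by rewrite lerDr.
rewrite [leLHS](_ : _ = 2 * normal_peak 1 * i.+1%:R *
   expR (- (i.+1%:R ^+ 2 / 2))); last by ring.
apply: (le_trans (ler_wpM2l _ e1)).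
  by rewrite mulr_ge0// mulr_ge0// normal_peak_ge0.
rewrite le_eqVlt; apply/orP; left; apply/eqP; field.
by rewrite nat1r pnatr_eq0.
Qed.

Lemma gauss_moment4_le : (\int[gauss]_x (x ^+ 4)%:E <= 3%:E)%E.
Proof.
have := @gauss_moment_le 2 isT; rewrite gauss_moment2 mule1.
by move=> /le_trans; apply.
Qed.

Lemma gauss_moment6_le :
  (\int[gauss]_x (x ^+ 6)%:E <= 5%:E * \int[gauss]_x (x ^+ 4)%:E)%E.
Proof. exact: (@gauss_moment_le 4 isT). Qed.

(** By symmetry the positive and negative parts have the same integral, finite
    because [|x| <= 1 + x^2]. *)
Lemma gauss_mean : (\int[gauss]_x x%:E = 0)%E.
Proof.
rewrite integralE.
have -> : ((@EFin R)^\- = fun x : R => (@EFin R)^\+ (- x)%R)%E.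
  by apply/funext => x; rewrite funenegE funeposE EFinN.
rewrite ge0_integral_gaussN; last 2 first.
- by apply: measurable_funepos; apply/measurable_EFinP.
- by move=> x; exact: funepos_ge0.
rewrite subee// ge0_fin_numE; last by apply: integral_ge0 => x _; exact: funepos_ge0.
apply: (@le_lt_trans _ _ (\int[gauss]_x (1 + x ^+ 2)%:E)%E).
  apply: ge0_le_integral => //.
  - by apply: measurable_funepos; apply/measurable_EFinP.
  - by apply/measurable_EFinP; apply: measurable_funD => //; exact: measurable_funX.
  - move=> x _; rewrite funeposE /maxe; case: ifP => _.
      by rewrite lee_fin addr_ge0// sqr_ge0.
    by rewrite lee_fin; nra.
under eq_integral do rewrite EFinD.
rewrite ge0_integralD//.
- by rewrite gauss_moment2 integral_cst// mul1e [X in (X + _)%E]probability_setT ltry.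
- by move=> x _; rewrite lee_fin sqr_ge0.
- by apply/measurable_EFinP; exact: measurable_funX.
Qed.

End gaussian_moments.

Section gaussian_law.
Context {R : realType} (gam : probability R R).
Local Notation gauss := (normal_prob (0 : R) 1).
Hypothesis gamE : forall A, measurable A -> gam A = gauss A.

(** A law on the reals and [normal_prob] live on two different copies of the
    Borel sigma-algebra; the identity map transports integrals between them. *)
Lemma integral_gaussian_law (f : R -> \bar R) : measurable_fun setT f ->
  (\int[gam]_x f x = \int[gauss]_x f x)%E.
Proof.
move=> mf.
have mid : @measurable_fun _ _ (measurableTypeR R) R setT id by move=> _ A mA; rewrite setTI.
pose idm : {RV (gauss : probability (measurableTypeR R) R) >-> R} :=
  @mfun_Sub _ _ (measurableTypeR R) R id (mem_set mid).
have ge0 (f' : R -> \bar R) : measurable_fun setT f' -> (forall x, 0 <= f' x)%E ->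
    (\int[gam]_x f' x = \int[gauss]_x f' x)%E.
  move=> mf' f'0; rewrite -[RHS](@ge0_integral_distribution _ _ _ _ _ _ idm f' mf' f'0).
  by apply: eq_measure_integral => A mA _; exact: gamE.
rewrite integralE [RHS]integralE; congr (_ - _)%E; apply: ge0 => //.
- exact: measurable_funepos.
- exact: measurable_funeneg.
Qed.

Let mX k : measurable_fun setT (fun x : R => (x ^+ k)%:E).
Proof. by apply/measurable_EFinP; exact: measurable_funX. Qed.

Lemma gaussian_law_mean : (\int[gam]_x x%:E = 0)%E.
Proof. by rewrite integral_gaussian_law ?gauss_mean//; exact/measurable_EFinP. Qed.

Lemma gaussian_law_moment2 : (\int[gam]_x (x ^+ 2)%:E = 1)%E.
Proof. by rewrite integral_gaussian_law ?gauss_moment2. Qed.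

Let norm_even k : ~~ odd k ->
  (\int[gam]_x (`|x| ^+ k)%:E = \int[gam]_x (x ^+ k)%:E)%E.
Proof.
move=> ek; apply: eq_integral => x _.
by rewrite -normrX ger0_norm// exprn_even_ge0.
Qed.

Lemma gaussian_law_normX4 : (\int[gam]_x (`|x| ^+ 4)%:E <= 3%:E)%E.
Proof. by rewrite norm_even// integral_gaussian_law// gauss_moment4_le. Qed.

Lemma gaussian_law_normX6 :
  (\int[gam]_x (`|x| ^+ 6)%:E <= 5%:E * \int[gam]_x (`|x| ^+ 4)%:E)%E.
Proof. by rewrite !norm_even// !integral_gaussian_law// gauss_moment6_le. Qed.

Lemma gaussian_law_normX6_lty : (\int[gam]_x (`|x| ^+ 6)%:E < +oo)%E.
Proof.
apply: (le_lt_trans gaussian_law_normX6).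
apply: (@le_lt_trans _ _ (5%:E * 3%:E)%E); last by rewrite -EFinM ltry.
by apply: lee_wpmul2l => //; exact: gaussian_law_normX4.
Qed.

End gaussian_law.

(** * Comparing one-dimensional means by matching moments *)

Section moment_matching.
Context {R : realType}.
Implicit Types (nu mu gam : probability R R) (f rho : R -> R) (t : nat -> R).

Lemma measurable_monomial_norm (k : nat) :
  measurable_fun setT (fun x : R => (`|x| ^+ k)%:E).
Proof.
apply/measurable_EFinP; apply: measurable_funX; exact: normr_measurable.
Qed.

Lemma normrX_le_add (m k : nat) (x : R) : (k <= m)%N ->
  `|x| ^+ k <= 1 + `|x| ^+ m.
Proof.
move=> km; have [x1|/ltW x1] := leP `|x| 1.
  by rewrite (@le_trans _ _ 1) ?exprn_ile1// lerDl exprn_ge0.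
by rewrite (@le_trans _ _ (`|x| ^+ m)) ?ler_weXn2l// lerDr.
Qed.

Lemma integrable_monomial_norm nu (m k : nat) :
  (\int[nu]_x (`|x| ^+ m)%:E < +oo)%E -> (k <= m)%N ->
  nu.-integrable setT (fun x : R => (`|x| ^+ k)%:E).
Proof.
move=> moo km; have mmn := measurable_monomial_norm.
apply/integrableP; split => //.
under eq_integral do rewrite gee0_abs ?lee_fin ?exprn_ge0//.
apply: (@le_lt_trans _ _ (\int[nu]_x (1 + (`|x| ^+ m)%:E)))%E.
  apply: ge0_le_integral => //.
  - by apply: emeasurable_funD.
  - by move=> x _; rewrite -EFinD lee_fin normrX_le_add.
rewrite ge0_integralD//.
by rewrite integral_cst// mul1e [X in (X + _)%E]probability_setT lte_add_pinfty// ltry.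
Qed.

Lemma integrable_monomial nu (m k : nat) :
  (\int[nu]_x (`|x| ^+ m)%:E < +oo)%E -> (k <= m)%N ->
  nu.-integrable setT (fun x : R => (x ^+ k)%:E).
Proof.
move=> moo km; apply: le_integrable (integrable_monomial_norm moo km) => //.
- by apply/measurable_EFinP; exact: measurable_funX.
- by move=> x _; rewrite /= lee_fin !normrX normr_id.
Qed.

Lemma Rintegral_monomials nu (m : nat) t :
  (forall j, (j < m)%N -> nu.-integrable setT (fun x : R => (x ^+ j)%:E)) ->
  nu.-integrable setT (fun x => (\sum_(j < m) t j * x ^+ j)%:E) /\
  \int[nu]_x (\sum_(j < m) t j * x ^+ j) =
  \sum_(j < m) t j * \int[nu]_x (x ^+ j).
Proof.
elim: m => [|m IH] im.
  under eq_fun do rewrite big_ord0; rewrite big_ord0; split.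
    exact: integrable0.
  under eq_Rintegral do rewrite big_ord0.
  by rewrite Rintegral_cst// mul0r.
have [] := IH (fun j jm => im j (ltnW jm)) => i1 e1.
have i2 : nu.-integrable setT (fun x : R => (t m * x ^+ m)%:E).
  under eq_fun do rewrite EFinM; exact: integrableZl (im m (ltnSn _)).
split.
  by under eq_fun do rewrite big_ord_recr /= EFinD; exact: integrableD.
under eq_Rintegral do rewrite big_ord_recr /=.
rewrite RintegralD// e1 big_ord_recr /=; congr (_ + _).
by rewrite RintegralZl//; exact: im.
Qed.

Lemma Rintegral_taylor nu (m : nat) f t rho (C : R) :
  measurable_fun setT f -> (forall x, `|f x| <= C) ->
  (forall j, (j < m)%N -> nu.-integrable setT (fun x : R => (x ^+ j)%:E)) ->
  nu.-integrable setT (EFin \o rho) ->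
  (forall x, `|f x - \sum_(j < m) t j * x ^+ j| <= rho x) ->
  `|\int[nu]_x f x - \sum_(j < m) t j * \int[nu]_x (x ^+ j)| <= \int[nu]_x rho x.
Proof.
move=> mf fC im irho frho.
have [iT <-] := Rintegral_monomials t im.
have fi := bounded_integrable nu mf fC.
have iB : nu.-integrable setT
    (EFin \o (fun x => f x - \sum_(j < m) t j * x ^+ j)).
  by rewrite /comp; under eq_fun do rewrite EFinB; exact: integrableB.
rewrite -RintegralB//; apply: (le_trans (le_normr_Rintegral measurableT iB)).
apply: le_Rintegral => //.
exact: (integrable_norm iB).
Qed.

(** Matching moments cancel the Taylor polynomials, so that only the two
    remainders contribute. *)
Lemma Rintegral_match nu1 nu2 (m : nat) f t rho1 rho2 (C : R) :
  measurable_fun setT f -> (forall x, `|f x| <= C) ->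
  (forall j, (j < m)%N -> nu1.-integrable setT (fun x : R => (x ^+ j)%:E)) ->
  (forall j, (j < m)%N -> nu2.-integrable setT (fun x : R => (x ^+ j)%:E)) ->
  (forall j, (j < m)%N ->
    (\int[nu1]_x (x ^+ j)%:E = \int[nu2]_x (x ^+ j)%:E)%E) ->
  nu1.-integrable setT (EFin \o rho1) ->
  nu2.-integrable setT (EFin \o rho2) ->
  (forall x, `|f x - \sum_(j < m) t j * x ^+ j| <= rho1 x) ->
  (forall x, `|f x - \sum_(j < m) t j * x ^+ j| <= rho2 x) ->
  `|\int[nu1]_x f x - \int[nu2]_x f x| <=
  \int[nu1]_x rho1 x + \int[nu2]_x rho2 x.
Proof.
move=> mf fC i1 i2 e12 ir1 ir2 f1 f2.
have := Rintegral_taylor mf fC i1 ir1 f1.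
have := Rintegral_taylor mf fC i2 ir2 f2.
have -> : \sum_(j < m) t j * \int[nu2]_x (x ^+ j) =
    \sum_(j < m) t j * \int[nu1]_x (x ^+ j).
  by apply: eq_bigr => j _; rewrite /Rintegral e12.
move=> h2 h1; apply: (le_trans (ler_distD _ _ _)); apply: lerD; first exact: h1.
by rewrite distrC.
Qed.

(** Integrated form of [r <= (1 + r^2) / 2], weighted by [r ^+ k.+2]. *)
Lemma Rintegral_normrX_le nu (k : nat) :
  (\int[nu]_x (`|x| ^+ k.+4)%:E < +oo)%E ->
  \int[nu]_x (`|x| ^+ k.+3) <=
  2^-1 * (\int[nu]_x (`|x| ^+ k.+2) + \int[nu]_x (`|x| ^+ k.+4)).
Proof.
move=> oo.
have i2 := integrable_monomial_norm oo (leqW (leqnSn k.+2)).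
have i3 := integrable_monomial_norm oo (leqnSn k.+3).
have i4 := integrable_monomial_norm oo (leqnn k.+4).
rewrite -RintegralD// -RintegralZl//; last first.
  by rewrite /comp; under eq_fun do rewrite EFinD; exact: integrableD.
apply: le_Rintegral => //.
- rewrite /comp; under eq_fun do rewrite EFinM EFinD.
  by apply: integrableZl => //; exact: integrableD.
- move=> x _; have r0 := normr_ge0 x; set r : R := `|x| in r0 *.
  rewrite (_ : r ^+ k.+4 = r ^+ k.+2 * r ^+ 2); last by rewrite -exprD addn2.
  rewrite (_ : r ^+ k.+3 = r ^+ k.+2 * r); last by rewrite -exprSr.
  rewrite -{2}[r ^+ k.+2]mulr1 -mulrDr mulrCA ler_wpM2l ?exprn_ge0//.
  by have := sqr_ge0 (r - 1); rewrite !expr2; nra.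
Qed.

Local Notation gauss := (normal_prob (0 : R) 1).

(** Both laws have mean zero and variance one, so [1 <= E|y|^3], while
    [E|g|^3 <= (E g^2 + E g^4) / 2 <= 2]; the two remainders together cost at
    most three times the third moment of [y]. *)
Lemma gauss_dist_two_moments gam mu f t (K C : R) :
  (forall A, measurable A -> gam A = gauss A) ->
  (\int[mu]_x x%:E = 0)%E -> (\int[mu]_x (x ^+ 2)%:E = 1)%E ->
  (\int[mu]_x (`|x| ^+ 3)%:E < +oo)%E -> 0 <= K ->
  measurable_fun setT f -> (forall x, `|f x| <= C) ->
  (forall x, `|f x - \sum_(j < 3) t j * x ^+ j| <= K * `|x| ^+ 3) ->
  `|\int[gam]_x f x - \int[mu]_x f x| <=
  3 * K * \int[mu]_x (`|x| ^+ 3).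
Proof.
move=> gamE mu1 mu2 mu3 K0 mf fC fK.
have g4 : (\int[gam]_x (`|x| ^+ 4)%:E < +oo)%E.
  by apply: (le_lt_trans (gaussian_law_normX4 gamE)); rewrite ltry.
have ig3 := integrable_monomial_norm g4 (isT : (3 <= 4)%N).
have im3 := integrable_monomial_norm mu3 (leqnn 3).
have igK : gam.-integrable setT (EFin \o (fun x => K * `|x| ^+ 3)).
  by rewrite /comp; under eq_fun do rewrite EFinM; exact: integrableZl.
have imK : mu.-integrable setT (EFin \o (fun x => K * `|x| ^+ 3)).
  by rewrite /comp; under eq_fun do rewrite EFinM; exact: integrableZl.
have := @Rintegral_match gam mu 3 f t _ _ C mf fC _ _ _ igK imK fK fK.
move=> /(_ _ _ _)/le_trans; apply.
- by move=> j j3; apply: (integrable_monomial g4); rewrite ltnW// ltnW.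
- by move=> j j3; apply: (integrable_monomial mu3); rewrite ltnW.
- case=> [|[|[|//]]] _.
  + under eq_integral do rewrite expr0; under [RHS]eq_integral do rewrite expr0.
    by rewrite !integral_cst// !mul1e [LHS]probability_setT [RHS]probability_setT.
  + under eq_integral do rewrite expr1; under [RHS]eq_integral do rewrite expr1.
    by rewrite (gaussian_law_mean gamE) mu1.
  + by rewrite (gaussian_law_moment2 gamE) mu2.
rewrite !RintegralZl//.
have g3 : \int[gam]_x (`|x| ^+ 3) <= 2.
  apply: (le_trans (@Rintegral_normrX_le gam 0 g4)).
  have -> : \int[gam]_x (`|x| ^+ 2) = 1.
    rewrite /Rintegral; under eq_integral do rewrite -normrX ger0_norm ?sqr_ge0//.
    by rewrite (gaussian_law_moment2 gamE).
  have : \int[gam]_x (`|x| ^+ 4) <= 3.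
    rewrite -lee_fin /Rintegral fineK; first exact: (gaussian_law_normX4 gamE).
    exact: (integrable_fin_num _ (integrable_monomial_norm g4 (leqnn 4))).
  lra.
have m3 : 1 <= \int[mu]_x (`|x| ^+ 3).
  have m2 : \int[mu]_x (`|x| ^+ 2) = 1.
    rewrite /Rintegral; under eq_integral do rewrite -normrX ger0_norm ?sqr_ge0//.
    by rewrite mu2.
  have i2 := integrable_monomial_norm mu3 (isT : (2 <= 3)%N).
  (* [2 r^3 + 1 - 3 r^2] vanishes to second order at [r = 1]. *)
  have : \int[mu]_x (3 * `|x| ^+ 2) <= \int[mu]_x (2 * `|x| ^+ 3 + 1).
    apply: le_Rintegral => //.
    - by rewrite /comp; under eq_fun do rewrite EFinM; exact: integrableZl.
    - rewrite /comp; under eq_fun do rewrite EFinD EFinM.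
      apply: integrableD => //; first exact: integrableZl.
      exact: finite_measure_integrable_cst.
    - move=> x _; have r0 := normr_ge0 x; set r : R := `|x| in r0 *.
      rewrite -subr_ge0 (_ : _ - _ = (r - 1) ^+ 2 * (2 * r + 1)); last by ring.
      by rewrite mulr_ge0 ?sqr_ge0// addr_ge0// mulr_ge0.
  rewrite RintegralZl// m2 RintegralD//; last 2 first.
  - by rewrite /comp; under eq_fun do rewrite EFinM; exact: integrableZl.
  - exact: finite_measure_integrable_cst.
  have -> : \int[mu]_x (1 : R) = 1.
    by rewrite Rintegral_cst// [X in fine X]probability_setT mulr1.
  by rewrite RintegralZl//; lra.
nra.
Qed.

(** Under [mu], which may lack a fifth moment, the fifth-order remainder serves
    where [|x| < a], as [|x|^5 <= a x^4] there, and the fourth-order one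
    elsewhere. Under the Gaussian law the fifth-order remainder costs
    [E|g|^5 <= (E g^4 + E g^6) / 2 <= 3 E g^4 = 3 E y^4]. *)
Lemma gauss_dist_four_moments gam mu f t (K4 K5 a C : R) :
  (forall A, measurable A -> gam A = gauss A) ->
  (forall k, (1 <= k <= 4)%N ->
    (\int[mu]_x (x ^+ k)%:E = \int[gauss]_x (x ^+ k)%:E)%E) ->
  0 <= K4 -> 0 <= K5 -> 1 <= a ->
  measurable_fun setT f -> (forall x, `|f x| <= C) ->
  `|t 4%N| <= K4 ->
  (forall x, `|f x - \sum_(j < 4) t j * x ^+ j| <= K4 * `|x| ^+ 4) ->
  (forall x, `|f x - \sum_(j < 5) t j * x ^+ j| <= K5 * `|x| ^+ 5) ->
  `|\int[gam]_x f x - \int[mu]_x f x| <=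
  2 * K4 * \int[mu]_x (`|x| ^+ 4 * \1_[set y | a <= `|y|] x)
  + 4 * K5 * a * \int[mu]_x (`|x| ^+ 4).
Proof.
move=> gamE mumom0 K40 K50 a1 mf fC t4 fK4 fK5.
have mumom k : (1 <= k <= 4)%N ->
    (\int[mu]_x (x ^+ k)%:E = \int[gam]_x (x ^+ k)%:E)%E.
  move=> k4; rewrite mumom0// (integral_gaussian_law gamE)//.
  by apply/measurable_EFinP; exact: measurable_funX.
have g6 := (gaussian_law_normX6_lty gamE).
have ig k (k6 : (k <= 6)%N) := integrable_monomial_norm g6 k6.
have X4 nu : (\int[nu]_x (`|x| ^+ 4)%:E = \int[nu]_x (x ^+ 4)%:E)%E.
  by apply: eq_integral => x _; rewrite -normrX ger0_norm// exprn_even_ge0.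
have m4 : (\int[mu]_x (`|x| ^+ 4)%:E < +oo)%E.
  by rewrite X4 mumom// -X4; apply: (le_lt_trans (gaussian_law_normX4 gamE)); rewrite ltry.
have im k (k4 : (k <= 4)%N) := integrable_monomial_norm m4 k4.
have mA : measurable [set y : R | a <= `|y|].
  rewrite -[X in measurable X]setTI.
  rewrite [X in measurable (_ `&` X)](_ : _ = (fun y : R => `|y|) @^-1` `[a, +oo[%classic).
    exact: (@normr_measurable R setT measurableT).
  by apply/seteqP; split => y /=; rewrite in_itv /= andbT.
have im4 : mu.-integrable setT
    (fun x : R => (`|x| ^+ 4 * \1_[set y | a <= `|y|] x)%:E).
  apply: (le_integrable _ _ _ (im 4%N isT)) => //.
    apply/measurable_EFinP; apply: measurable_funM.
      by apply: measurable_funX; exact: normr_measurable.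
    exact: measurable_indic.
  move=> x _; rewrite /= lee_fin normrM ger0_norm ?exprn_ge0//.
  rewrite ler_piMr ?exprn_ge0// indicE; case: (x \in _); rewrite ?normr1 ?normr0//.
pose rho (x : R) := 2 * K4 * (`|x| ^+ 4 * \1_[set y | a <= `|y|] x)
   + K5 * a * `|x| ^+ 4.
have igK : gam.-integrable setT (EFin \o (fun x => K5 * `|x| ^+ 5)).
  by rewrite /comp; under eq_fun do rewrite EFinM; apply: integrableZl => //; exact: ig.
have irho1 : mu.-integrable setT
    (EFin \o (fun x => 2 * K4 * (`|x| ^+ 4 * \1_[set y | a <= `|y|] x))).
  by rewrite /comp; under eq_fun do rewrite EFinM; exact: integrableZl.
have irho2 : mu.-integrable setT (EFin \o (fun x => K5 * a * `|x| ^+ 4)).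
  by rewrite /comp; under eq_fun do rewrite EFinM; apply: integrableZl => //; exact: im.
have irho : mu.-integrable setT (EFin \o rho).
  by rewrite /comp /rho; under eq_fun do rewrite EFinD; exact: integrableD.
have frho x : `|f x - \sum_(j < 5) t j * x ^+ j| <= rho x.
  rewrite /rho indicE; have [ax|xa] := boolP (x \in _).
    rewrite mulr1; apply: (@le_trans _ _ (2 * K4 * `|x| ^+ 4)); last first.
      by rewrite lerDl mulr_ge0 ?exprn_ge0// mulr_ge0// (le_trans ler01).
    rewrite big_ord_recr /= opprD addrA; apply: (le_trans (ler_normB _ _)).
    rewrite mulr2n mulrDl mulrDl mul1r; apply: lerD; first exact: fK4.
    by rewrite normrM normrX ler_wpM2r ?exprn_ge0.
  rewrite mulr0 mulr0 add0r; apply: (le_trans (fK5 x)).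
  rewrite -mulrA ler_wpM2l// exprS ler_wpM2r ?exprn_ge0//.
  by move: xa; rewrite notin_setE /= => /negP; rewrite -ltNge => /ltW.
have := @Rintegral_match gam mu 5 f t _ _ C mf fC _ _ _ igK irho fK5 frho.
move=> /(_ _ _ _)/le_trans; apply.
- by move=> j j5; apply: (integrable_monomial g6); rewrite (leq_trans (ltnW j5)).
- by move=> j j5; apply: (integrable_monomial m4).
- case=> [|k] k4; last by rewrite mumom.
  under eq_integral do rewrite expr0; under [RHS]eq_integral do rewrite expr0.
  by rewrite !integral_cst// !mul1e [LHS]probability_setT [RHS]probability_setT.
rewrite RintegralD// !RintegralZl//; [|exact: im|exact: ig].
have e4 : \int[gam]_x (`|x| ^+ 4) = \int[mu]_x (`|x| ^+ 4).
  by rewrite /Rintegral !X4 mumom.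
have g5 : \int[gam]_x (`|x| ^+ 5) <= 3 * \int[mu]_x (`|x| ^+ 4).
  apply: (le_trans (@Rintegral_normrX_le gam 2 g6)); rewrite -e4.
  have : \int[gam]_x (`|x| ^+ 6) <= 5 * \int[gam]_x (`|x| ^+ 4).
    rewrite -lee_fin /Rintegral EFinM !fineK; first exact: (gaussian_law_normX6 gamE).
      exact: (integrable_fin_num _ (ig 4%N isT)).
    exact: (integrable_fin_num _ (ig 6%N isT)).
  lra.
have p4 : 0 <= \int[mu]_x (`|x| ^+ 4).
  by apply: Rintegral_ge0 => x _; exact: exprn_ge0.
rewrite addrCA lerD2l.
have h1 : K5 * \int[gam]_x (`|x| ^+ 5) <= 3 * (K5 * a * \int[mu]_x (`|x| ^+ 4)).
  apply: (@le_trans _ _ (K5 * (3 * \int[mu]_x (`|x| ^+ 4)))).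
    by rewrite ler_wpM2l.
  rewrite mulrCA ler_wpM2l// -mulrA ler_wpM2l// ler_peMl//.
lra.
Qed.

End moment_matching.

(** * Measurability of limits and almost sure convergence *)

Section measurable_limits.
Context {R : realType} d (T : measurableType d) (h : nat -> T -> R).
Hypothesis mh : forall n, measurable_fun setT (h n).

Let oscillation k m : set T :=
  [set t | forall n, (m <= n)%N -> `|h n t - h m t| <= k.+1%:R^-1].

Let measurable_oscillation k m : measurable (oscillation k m).
Proof.
have -> : oscillation k m = \bigcap_(n in [set n | (m <= n)%N])
    ((fun t => `|h n t - h m t|) @^-1` `]-oo, k.+1%:R^-1]%classic).
  by apply/seteqP; split => t /= ht n mn; have := ht n mn; rewrite /= in_itv.
apply: bigcap_measurable; first by exists m => /=.
move=> n _; rewrite -[X in measurable X]setTI.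
have md : measurable_fun setT (fun t => `|h n t - h m t|).
  by apply: measurableT_comp => //; exact: measurable_funB.
exact: md.
Qed.

(** The set of convergence is measurable because, the reals being complete, it
    is described by countably many conditions on countably many terms. *)
Lemma measurable_cvgn : measurable [set t | cvgn (fun n => h n t)].
Proof.
rewrite [X in measurable X](_ : _ = \bigcap_k \bigcup_m oscillation k m).
  apply: bigcap_measurable => [|k _]; first by exists 0%N.
  by apply: bigcup_measurable => m _; exact: measurable_oscillation.
apply/seteqP; split => t /=.
- move=> /cvg_ex[l /= hl] k _.
  have e0 : 0 < (k.+1%:R^-1 / 2 : R) by rewrite divr_gt0.
  move/cvgrPdist_le : hl => /(_ _ e0)[m _ hm].
  exists m => // n mn; rewrite [k.+1%:R^-1]splitr.
  rewrite -(subrKA l); apply: (le_trans (ler_normD _ _)); apply: lerD.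
    by rewrite distrC; exact: hm.
  exact: (hm m (leqnn m)).
- move=> ht; apply/cauchy_cvgP; apply: cauchy_exP => e e0.
  have [k ke] : exists k, k.+1%:R^-1 < e.
    by have [k] := ltr_add_invr (e0 : 0 < e); rewrite add0r => ke; exists k.
  have [m _ hm] := ht k I.
  exists (h m t), m => // n mn; rewrite /ball /= distrC.
  exact: le_lt_trans (hm n mn) ke.
Qed.

(** Off the set of convergence the limit is a fixed default value. *)
Lemma measurable_limn : measurable_fun setT (fun t => limn (fun n => h n t)).
Proof.
pose C := [set t | cvgn (fun n => h n t)].
pose g n t := if t \in C then h n t else (point : R).
apply: (@measurable_fun_cvg _ _ _ setT g).
- move=> m; apply: measurable_fun_ifT => //.
    apply: (measurable_fun_bool true); rewrite setTI.
    rewrite (_ : _ @^-1` _ = C); first exact: measurable_cvgn.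
    by apply/seteqP; split => t /=; [move/set_mem|move/mem_set].
- move=> t _; rewrite /g; case: (boolP (t \in C)) => tC.
    by move: tC; rewrite inE.
  rewrite dvgP; first exact: cvg_cst.
  by move: tC; rewrite notin_setE.
Qed.

End measurable_limits.

Lemma integrable_comp_RV {R : realType} d (T : measurableType d)
    (P : probability T R) (X : {RV P >-> R}) (f : R -> \bar R) :
  (distribution P X).-integrable setT f -> P.-integrable setT (f \o X).
Proof.
move=> fi; have mf := measurable_int _ fi.
apply/integrableP; split; first exact: measurableT_comp.
have /integrableP[_] := fi.
by rewrite ge0_integral_distribution//; exact: measurableT_comp.
Qed.

Section orthonormal_family.
Context {R : realType} d (T : measurableType d) (P : probability T R).
Context (I : eqType) (X : I -> {RV P >-> R}) (D : set I).
Hypothesis indep : mutually_independent D X.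
Hypothesis mean0 : forall i, D i -> (\int[distribution P (X i)]_x x%:E = 0)%E.
Hypothesis var1 : forall i, D i ->
  (\int[distribution P (X i)]_x (x ^+ 2)%:E = 1)%E.

Let norm2 i : D i -> (\int[distribution P (X i)]_x (`|x| ^+ 2)%:E < +oo)%E.
Proof.
move=> Di; rewrite (eq_integral (fun x : R => (x ^+ 2)%:E)) ?var1 ?ltry//.
by move=> x _; rewrite -normrX ger0_norm// sqr_ge0.
Qed.

Let integrableX i : D i -> P.-integrable setT (EFin \o X i).
Proof.
move=> Di; have := integrable_monomial (norm2 Di) (isT : (1 <= 2)%N).
by move=> /integrable_comp_RV; apply: eq_integrable => // w _ /=; rewrite expr1.
Qed.

Let integrableX2 i : D i -> P.-integrable setT (fun w => (X i w ^+ 2)%:E).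
Proof.
move=> Di; have := integrable_monomial (norm2 Di) (isT : (2 <= 2)%N).
exact: integrable_comp_RV.
Qed.

Let integrableXX i j : D i -> D j -> P.-integrable setT (fun w => (X i w * X j w)%:E).
Proof.
move=> Di Dj; apply: le_integrable (integrableD measurableT (integrableX2 Di) (integrableX2 Dj)) => //.
- by apply/measurable_EFinP; exact: measurable_funM.
- move=> w _; rewrite -EFinD /= lee_fin.
  rewrite [leRHS]ger0_norm ?addr_ge0 ?sqr_ge0// ler_norml.
  move: (X i w) (X j w) => a b.
  have := sqr_ge0 (a + b); have := sqr_ge0 (a - b).
  have := sqr_ge0 a; have := sqr_ge0 b; rewrite sqrrB sqrrD.
  by move=> *; apply/andP; split; lra.
Qed.

Lemma uncorrelated i j : D i -> D j -> i != j -> \int[P]_w (X i w * X j w) = 0.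
Proof.
move=> Di Dj ij.
have ji : j == i = false by apply/negbTE; rewrite eq_sym.
have ind A B : measurable A -> measurable B ->
    P (X i @^-1` A `&` X j @^-1` B) = (P (X i @^-1` A) * P (X j @^-1` B))%E.
  move=> mA mB.
  have := indep (s := [:: i; j]) (A := fun k => if k == i then A else B).
  rewrite big_cons big_seq1 eqxx ji => <-.
  - congr (P _); apply/seteqP; split => [w /= [Aw Bw] k|w /= AB].
      by rewrite !inE => /orP[/eqP->|/eqP->]; rewrite ?eqxx ?ji.
    split; first by have := AB i (mem_head _ _); rewrite eqxx.
    by have := AB j; rewrite !inE eqxx orbT ji; apply.
  - by rewrite /= inE ij.
  - by move=> k; rewrite !inE => /orP[/eqP->|/eqP->].
  - by move=> k _; case: ifP.
have iXj := integrable_monomial (norm2 Dj) (isT : (1 <= 2)%N).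
have iXj' : (distribution P (X j)).-integrable setT (fun x : R => x%:E).
  by apply: eq_integrable iXj => // x _; rewrite expr1.
pose f (p : R * R) : \bar R := (p.1 * p.2)%:E.
have mf : measurable_fun setT f by apply/measurable_EFinP; exact: measurable_funM.
have inner w : (\int[distribution P (X j)]_x f (X i w, x) = 0)%E.
  by rewrite /f /=; under eq_integral do rewrite EFinM; rewrite integralZl// mean0// mule0.
have e0 : (\int[P]_w \int[distribution P (X j)]_x f (X i w, x) = 0)%E.
  by under eq_integral do rewrite inner; exact: integral0.
have := integral_indep ind mf; rewrite e0 /Rintegral => -> //=.
have iaj := integrable_norm iXj'.
have -> : (\int[P]_w \int[distribution P (X j)]_x `|f (X i w, x)|)%E =
    (\int[P]_w (`|X i w|%:E * \int[distribution P (X j)]_x `|x|%:E))%E.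
  apply: eq_integral => w _; rewrite -integralZl//.
  by apply: eq_integral => x _; rewrite /f /= normrM EFinM.
have := integrable_norm (integrableX Di) => iai.
have fj := integrable_fin_num measurableT iaj.
rewrite -(fineK fj) integralZr//.
rewrite -(fineK (integrable_fin_num measurableT iai)) -EFinM.
by rewrite ltry.
Qed.

Let cross (k : I) (b : I -> R) (r : seq I) : D k -> {in r, forall i, D i} ->
  k \notin r ->
  P.-integrable setT (fun w => (X k w * \sum_(i <- r) b i * X i w)%:E) /\
  \int[P]_w (X k w * \sum_(i <- r) b i * X i w) = 0.
Proof.
move=> Dk; elim: r => [|j r IH] rD.
  under eq_fun do rewrite big_nil mulr0; split; first exact: integrable0.
  by under eq_Rintegral do rewrite big_nil mulr0; rewrite Rintegral_cst// mul0r.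
rewrite inE negb_or => /andP[kj kr].
have Dj : D j by apply: rD; rewrite mem_head.
have [|i1 e1] := IH _ kr; first by move=> i ir; apply: rD; rewrite inE ir orbT.
have i2 : P.-integrable setT (fun w => (b j * (X k w * X j w))%:E).
  by under eq_fun do rewrite EFinM; apply: integrableZl => //; exact: integrableXX.
have E w : X k w * (\sum_(i <- j :: r) b i * X i w) =
    b j * (X k w * X j w) + X k w * \sum_(i <- r) b i * X i w.
  by rewrite big_cons mulrDr mulrCA.
split.
  by under eq_fun do rewrite E EFinD; exact: integrableD.
under eq_Rintegral do rewrite E; rewrite RintegralD// e1 addr0.
by rewrite RintegralZl ?uncorrelated ?mulr0//; exact: integrableXX.
Qed.

Lemma second_moment_sum (b : I -> R) (r : seq I) : uniq r ->
  {in r, forall i, D i} ->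
  P.-integrable setT (fun w => ((\sum_(i <- r) b i * X i w) ^+ 2)%:E) /\
  \int[P]_w ((\sum_(i <- r) b i * X i w) ^+ 2) = \sum_(i <- r) b i ^+ 2.
Proof.
elim: r => [_ _|k r IH /= /andP[kr ur] rD].
  under eq_fun do rewrite big_nil expr0n /=; rewrite big_nil.
  split; first exact: integrable0.
  under eq_Rintegral do rewrite big_nil expr0n /=.
  by rewrite Rintegral_cst// mul0r.
have Dk : D k by apply: rD; rewrite mem_head.
have rD' : {in r, forall i, D i} by move=> i ir; apply: rD; rewrite inE ir orbT.
have [i1 e1] := IH ur rD'.
have [i2 e2] := cross b Dk rD' kr.
have i3 := integrableX2 Dk.
have E w : (\sum_(i <- k :: r) b i * X i w) ^+ 2 =
    (b k ^+ 2 * X k w ^+ 2 + 2 * b k * (X k w * \sum_(i <- r) b i * X i w))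
    + (\sum_(i <- r) b i * X i w) ^+ 2.
  by rewrite big_cons; ring.
have i3' : P.-integrable setT (fun w => (b k ^+ 2 * X k w ^+ 2)%:E).
  by under eq_fun do rewrite EFinM; exact: integrableZl.
have i2' : P.-integrable setT
    (fun w => (2 * b k * (X k w * \sum_(i <- r) b i * X i w))%:E).
  by under eq_fun do rewrite EFinM; exact: integrableZl.
have i23 : P.-integrable setT (fun w => (b k ^+ 2 * X k w ^+ 2
     + 2 * b k * (X k w * \sum_(i <- r) b i * X i w))%:E).
  by under eq_fun do rewrite EFinD; exact: integrableD.
split.
  by under eq_fun do rewrite E EFinD; exact: integrableD.
under eq_Rintegral do rewrite E.
rewrite RintegralD// RintegralD// RintegralZl// RintegralZl// e2 mulr0 addr0 e1.
have -> : \int[P]_w (X k w ^+ 2) = 1.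
  have := @integral_distribution _ _ _ _ _ P (X k) (fun x : R => (x ^+ 2)%:E).
  rewrite var1// /Rintegral => <- //.
  by apply/measurable_EFinP; exact: measurable_funX.
by rewrite mulr1 big_cons.
Qed.

End orthonormal_family.

Section almost_sure_convergence.
Context {R : realType} d (T : measurableType d) (P : probability T R).

Lemma sum_geometric_half_le (n : nat) :
  \sum_(0 <= p < n) (2 ^- p : R) <= 2.
Proof.
suff -> : \sum_(0 <= p < n) (2 ^- p : R) = 2 - 2 * 2 ^- n.
  by rewrite gerBl mulr_ge0// invr_ge0 exprn_ge0.
elim: n => [|n IH]; first by rewrite big_nil expr0 invr1; lra.
rewrite big_nat_recr//= IH exprS invfM.
set x := 2 ^- n; lra.
Qed.

(** The weights [2^-p] turn second moments into first moments:
    [|Y| <= 2^-p + 2^p Y^2], whence the series of the [E |Y p|] converges and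
    the series of the [Y p] converges absolutely almost surely. *)
Lemma ae_cvg_series (Y : nat -> T -> R) (v : nat -> R) (c : R) :
  (forall p, measurable_fun setT (Y p)) ->
  (forall p, P.-integrable setT (fun w => (Y p w ^+ 2)%:E)) ->
  (forall p, \int[P]_w (Y p w ^+ 2) <= v p) ->
  (forall n, \sum_(0 <= p < n) 2 ^+ p * v p <= c) ->
  {ae P, forall w, cvgn (series (fun p => Y p w))}.
Proof.
move=> mY iY Yv vc.
have mabs p : measurable_fun setT (fun w => `|Y p w|%:E).
  by apply/measurable_EFinP; exact: measurableT_comp.
pose G w := (\sum_(0 <= p <oo) `|Y p w|%:E)%E.
have mG : measurable_fun setT G.
  have := @ge0_emeasurable_sum _ T R setT (fun p w => `|Y p w|%:E) xpredT.
  by apply.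
have intY p : (\int[P]_w `|Y p w|%:E <= (2 ^- p + 2 ^+ p * v p)%:E)%E.
  have ib : P.-integrable setT (fun w => (2 ^- p + 2 ^+ p * Y p w ^+ 2)%:E).
    under eq_fun do rewrite EFinD EFinM; apply: integrableD => //.
      exact: finite_measure_integrable_cst.
    exact: integrableZl.
  apply: (@le_trans _ _ (\int[P]_w (2 ^- p + 2 ^+ p * Y p w ^+ 2)%:E)%E).
    apply: ge0_le_integral => //.
    - exact: (measurable_int _ ib).
    - move=> w _; rewrite lee_fin -[Y p w ^+ 2]real_normK ?num_real//.
      have q0 : 0 < 2 ^+ p :> R by rewrite exprn_gt0.
      have := sqr_ge0 (2 ^+ p * `|Y p w| - 1).
      set q : R := 2 ^+ p in q0 *; set y : R := `|Y p w|.
      have y0 : 0 <= y by exact: normr_ge0.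
      move=> h; rewrite -(ler_pM2l q0) mulrDr divff ?gt_eqF//.
      by rewrite !expr2 in h *; nra.
  rewrite -[leLHS](fineK (integrable_fin_num measurableT ib)) lee_fin.
  rewrite -/(Rintegral P setT (fun w => 2 ^- p + 2 ^+ p * Y p w ^+ 2)).
  rewrite RintegralD//; last 2 first.
  - exact: finite_measure_integrable_cst.
  - by rewrite /comp; under eq_fun do rewrite EFinM; exact: integrableZl.
  rewrite Rintegral_cst// [X in _ * fine X]probability_setT mulr1 lerD2l.
  rewrite RintegralZl//; last exact: iY.
  by apply: ler_wpM2l; rewrite ?exprn_ge0.
have iG : P.-integrable setT G.
  apply/integrableP; split => //.
  under eq_integral do rewrite gee0_abs ?nneseries_ge0//.
  rewrite /G integral_nneseries//.
  apply: (@le_lt_trans _ _ (2 + c)%:E); last by rewrite ltry.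
  apply: lime_le.
    by apply: is_cvg_nneseries => p _ _; exact: integral_ge0.
  apply: nearW => n.
  apply: (@le_trans _ _ (\sum_(0 <= p < n) (2 ^- p + 2 ^+ p * v p)%:E)%E).
    by apply: lee_sum.
  rewrite sumEFin lee_fin big_split /=; apply: lerD => //.
  exact: sum_geometric_half_le.
have := integrable_ae measurableT iG.
apply: filterS => w /(_ I) Gfin.
apply: normed_cvg; apply: nondecreasing_is_cvgn.
  apply/nondecreasing_seqP => n /=; rewrite /series /= big_nat_recr//=.
  by rewrite lerDl.
exists (fine (G w)) => _ [n _ <-] /=.
rewrite -lee_fin fineK// /series /= -sumEFin.
exact: nneseries_lim_ge.
Qed.

End almost_sure_convergence.

(** * The Gibbs average as a function of one disorder variable *)

Section truncated_model.
Context {R : realType} (N : nat).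
Implicit Types (beta : nat -> R) (h : R) (J : seq 'I_N -> R) (s : config N).

Definition coupling beta (p : nat) : R := beta p / N%:R `^ ((p%:R - 1) / 2).

Definition spin_prod s (i : seq 'I_N) : R := \prod_(k <- i) spin R s k.

Definition layer beta J (p : nat) s : R :=
  coupling beta p * \sum_(i : p.-tuple 'I_N) J i * \prod_(k < p) spin R s (tnth i k).

Definition truncated_hamiltonian beta h (M : nat) J s : R :=
  \sum_(2 <= p < M) layer beta J p s + h * \sum_(i < N) spin R s i.

Definition multi_indices (M : nat) : seq (seq 'I_N) :=
  [seq tval t | p <- index_iota 2 M, t <- enum {: p.-tuple 'I_N}].

Lemma normr_spin_prod s i : `|spin_prod s i| = 1.
Proof.
rewrite /spin_prod; elim: i => [|k i IH]; first by rewrite big_nil normr1.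
by rewrite big_cons normrM IH mulr1 /spin normrX normrN1 expr1n.
Qed.

Lemma layerE beta J p s :
  layer beta J p s =
  \sum_(i : p.-tuple 'I_N) coupling beta (size i) * (J i * spin_prod s i).
Proof.
rewrite /layer mulr_sumr; apply: eq_bigr => t _.
by rewrite size_tuple /spin_prod big_tuple.
Qed.

Lemma uniq_multi_indices M : uniq (multi_indices M).
Proof.
apply: allpairs_uniq_dep => [|p _|].
- exact: iota_uniq.
- exact: enum_uniq.
- move=> [p t] [q u] _ _ /= tu.
  have pq : p = q by rewrite -(size_tuple t) tu size_tuple.
  by move: u tu; rewrite -pq => u /val_inj ->.
Qed.

Lemma mem_multi_indices M (i : seq 'I_N) :
  (i \in multi_indices M) = (2 <= size i < M)%N.
Proof.
apply/allpairsPdep/idP => [[p [t [+ _ ->]]]|i2].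
  by rewrite mem_index_iota size_tuple.
by exists (size i), (in_tuple i); rewrite mem_index_iota mem_enum.
Qed.

Lemma sum_multi_indices_size (f : nat -> R) M :
  \sum_(i <- multi_indices M) f (size i) =
  \sum_(2 <= p < M) (N ^ p)%:R * f p.
Proof.
rewrite big_allpairs_dep; apply: eq_bigr => p _.
rewrite big_enum /= (eq_bigr (fun=> f p)); last by move=> t _; rewrite size_tuple.
by rewrite sumr_const card_tuple card_ord mulr_natl.
Qed.

Lemma truncated_hamiltonianE beta h M J s :
  truncated_hamiltonian beta h M J s =
  \sum_(i <- multi_indices M) coupling beta (size i) * (J i * spin_prod s i)
  + h * \sum_(i < N) spin R s i.
Proof.
congr (_ + _); rewrite big_allpairs_dep; apply: eq_bigr => p _.
by rewrite big_enum layerE.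
Qed.

Definition set_coord J (i : seq 'I_N) (x : R) : seq 'I_N -> R :=
  fun j => if j == i then x else J j.

Lemma truncated_hamiltonian_set_coord beta h M J s i x : i \in multi_indices M ->
  truncated_hamiltonian beta h M (set_coord J i x) s =
  truncated_hamiltonian beta h M (set_coord J i 0) s
  + x * (coupling beta (size i) * spin_prod s i).
Proof.
move=> iM; rewrite !truncated_hamiltonianE.
rewrite !(bigD1_seq i iM (uniq_multi_indices M)) /= /set_coord eqxx.
rewrite (eq_bigr (fun j => coupling beta (size j) *
  ((if j == i then 0 else J j) * spin_prod s j))); first by ring.
by move=> j /negbTE ->.
Qed.

Variable n : nat.
Implicit Types (L : {ffun 'I_n -> config N} -> R) (H : config N -> R).

Definition gibbs_avg H L : R :=
  \sum_(s : {ffun 'I_n -> config N}) L s *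
  \prod_(l < n) (expR (H (s l)) / \sum_(s' : config N) expR (H s')).

(** The product of [n] copies of the Gibbs measure is the Gibbs measure of the
    sum of the energies of the replicas. *)
Lemma gibbs_avg_tilt (a u : config N -> R) L x :
  gibbs_avg (fun s => a s + x * u s) L =
  tilt_avg (fun s : {ffun 'I_n -> config N} => \sum_(l < n) a (s l))
           (fun s : {ffun 'I_n -> config N} => \sum_(l < n) u (s l)) L x.
Proof.
rewrite /gibbs_avg /tilt_avg.
have E (s : {ffun 'I_n -> config N}) :
    expR (\sum_(l < n) a (s l) + x * \sum_(l < n) u (s l)) =
    \prod_(l < n) expR (a (s l) + x * u (s l)).
  by rewrite mulr_sumr -big_split expR_sum.
have -> : \sum_(s : {ffun 'I_n -> config N})
    expR (\sum_(l < n) a (s l) + x * \sum_(l < n) u (s l)) =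
    \prod_(l < n) \sum_(s' : config N) expR (a s' + x * u s').
  rewrite (bigA_distr_bigA (fun (l : 'I_n) s => expR (a s + x * u s))) /=.
  by apply: eq_bigr => s _; rewrite E.
rewrite mulr_suml; apply: eq_bigr => s _.
by rewrite E -mulrA prodf_div.
Qed.

Lemma card_replicas_gt0 : (0 < #|{: {ffun 'I_n -> config N}}|)%N.
Proof. by apply/card_gt0P; exists [ffun=> [ffun=> true]]. Qed.

Lemma normr_gibbs_avg H L : (forall r, `|L r| <= 1) -> `|gibbs_avg H L| <= 1.
Proof.
move=> L1; have := gibbs_avg_tilt H (fun=> 0) L 0.
under [X in gibbs_avg X L]eq_fun do rewrite mulr0 addr0.
by move=> ->; apply: normr_tilt_avg => //; exact: card_replicas_gt0.
Qed.

(** The disorder variable of index [i] enters the energy of a configuration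
    linearly, with slope the coupling constant up to sign; over [n] replicas the
    tilt is thus at most [U]. *)
Lemma gibbs_avg_taylor beta h M J L i : (forall r, `|L r| <= 1) ->
  (forall p, (2 <= p)%N -> 0 <= beta p) -> i \in multi_indices M ->
  let U := n%:R * coupling beta (size i) in
  let F x := gibbs_avg (truncated_hamiltonian beta h M (set_coord J i x)) L in
  exists t : nat -> R,
    (forall m, `|t m| <= 2 ^+ 'C(m.+1, 2) * U ^+ m / m`!%:R) /\
    (forall m x, `|F x - \sum_(j < m) t j * x ^+ j| <=
                 2 ^+ 'C(m.+1, 2) * U ^+ m / m`!%:R * `|x| ^+ m).
Proof.
move=> L1 beta0 iM U F.
pose A (s : {ffun 'I_n -> config N}) :=
  \sum_(l < n) truncated_hamiltonian beta h M (set_coord J i 0) (s l).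
pose u (s : {ffun 'I_n -> config N}) :=
  \sum_(l < n) coupling beta (size i) * spin_prod (s l) i.
have FE x : F x = tilt_avg A u L x.
  rewrite /F -(gibbs_avg_tilt (truncated_hamiltonian beta h M (set_coord J i 0))
    (fun s => coupling beta (size i) * spin_prod s i)).
  congr gibbs_avg; apply/funext => s.
  exact: truncated_hamiltonian_set_coord.
have i2 : (2 <= size i)%N by move: iM; rewrite mem_multi_indices => /andP[].
have c0 : 0 <= coupling beta (size i).
  by rewrite divr_ge0 ?beta0// powR_ge0.
have uU r : `|u r| <= U.
  apply: (le_trans (ler_norm_sum _ _ _)).
  rewrite (eq_bigr (fun=> coupling beta (size i))) ; last first.
    by move=> l _; rewrite normrM normr_spin_prod mulr1 ger0_norm.
  by rewrite sumr_const card_ord /U mulr_natl.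
have bound m x : `|tilt_deriv m A u L x| <= 2 ^+ 'C(m.+1, 2) * U ^+ m.
  by have := normr_tilt_deriv m A x card_replicas_gt0 uU L1; rewrite mulr1.
exists (fun m => tilt_deriv m A u L 0 / m`!%:R); split.
  by move=> m; rewrite normrM normfV normr_nat ler_wpM2r ?invr_ge0.
move=> m x; rewrite FE.
apply: (@taylor_le _ (fun k => tilt_deriv k A u L)) => [k y|y].
  by apply: is_derive_tilt_deriv; exact: card_replicas_gt0.
exact: bound.
Qed.

Lemma measurable_gibbs_avg d (T : measurableType d) (H : T -> config N -> R) L :
  (forall s, measurable_fun setT (fun t => H t s)) ->
  measurable_fun setT (fun t => gibbs_avg (H t) L).
Proof.
move=> mH.
have mE s : measurable_fun setT (fun t => expR (H t s)).
  exact: measurableT_comp.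
(* The partition function is positive, so its inverse is [expR (- ln _)]. *)
have mZ : measurable_fun setT (fun t => (\sum_(s : config N) expR (H t s))^-1).
  have -> : (fun t => (\sum_(s : config N) expR (H t s))^-1) =
      (fun t => expR (- ln (\sum_(s : config N) expR (H t s)))).
    apply/funext => t; rewrite expRN lnK// posrE; apply: sum_expR_gt0.
    by apply/card_gt0P; exists [ffun=> true].
  apply: measurableT_comp => //; apply: measurableT_comp => //.
  apply: measurableT_comp => //; exact: measurable_sum.
apply: measurable_sum => s; apply: measurable_funM => //.
by apply: measurable_prod => l _; exact: measurable_funM.
Qed.

Lemma measurable_truncated_hamiltonian d (T : measurableType d)
    (J : T -> seq 'I_N -> R) beta h M s :
  (forall i, measurable_fun setT (fun t => J t i)) ->
  measurable_fun setT (fun t => truncated_hamiltonian beta h M (J t) s).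
Proof.
move=> mJ; under eq_fun do rewrite truncated_hamiltonianE.
apply: measurable_funD => //; apply: measurable_sum => i.
by apply: measurable_funM => //; exact: measurable_funM.
Qed.

Lemma coord_measurable_gibbs_avg beta h M L :
  coord_measurable (fun J => gibbs_avg (truncated_hamiltonian beta h M J) L).
Proof.
move=> d T J mJ; apply: measurable_gibbs_avg => s.
exact: measurable_truncated_hamiltonian.
Qed.

End truncated_model.

(** * Convergence of the truncated model *)

Section truncation_limit.
Context {R : realType} (N n : nat) (beta : nat -> R) (h : R).
Context (L : {ffun 'I_n -> config N} -> R).
Hypotheses (N1 : (1 <= N)%N) (beta_ge0 : forall p, (2 <= p)%N -> 0 <= beta p).

(** The exponent of [N] left over when the [N ^ p] couplings of order [p] are
    summed at power [k]. *)
Lemma sum_coupling_pow_le (k p : nat) (e : R) : (2 <= p)%N ->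
  p%:R - (p%:R - 1) / 2 * k%:R <= - e ->
  (N ^ p)%:R * coupling N beta p ^+ k <= beta p ^+ k / N%:R `^ e.
Proof.
move=> p2 pe; have N1' : 1 <= N%:R :> R by rewrite ler1n.
have N0 : N%:R != 0 :> R by rewrite pnatr_eq0 -lt0n.
rewrite /coupling exprMn exprVn -(powR_mulrn k (powR_ge0 _ _)) -powRrM -!powRN.
rewrite natrX -(powR_mulrn p (ler0n _ N)) mulrCA.
apply: ler_wpM2l; first by rewrite exprn_ge0// beta_ge0.
rewrite -powRD; last by rewrite N0 implybT.
exact: ler_powR.
Qed.

Lemma cvg_gibbs_avg (H : nat -> config N -> R) (G : config N -> R) :
  (forall s, H M s @[M --> \oo] --> G s) ->
  gibbs_avg (H M) L @[M --> \oo] --> gibbs_avg G L.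
Proof.
move=> HG.
have cE s : expR (H M s) @[M --> \oo] --> expR (G s).
  by apply: continuous_cvg => //; exact: continuous_expR.
have Z0 : \sum_(s : config N) expR (G s) != 0.
  by rewrite gt_eqF// sum_expR_gt0//; apply/card_gt0P; exists [ffun=> true].
apply: cvg_big; first exact: add_continuous.
move=> s _; apply: cvgM; first exact: cvg_cst.
apply: cvg_big; first exact: mul_continuous.
move=> l _; apply: cvgM; first exact: cE.
apply: cvgV => //; apply: cvg_big; first exact: add_continuous.
by move=> s' _; exact: cE.
Qed.

Context d (T : measurableType d) (P : probability T R).
Context (X : seq 'I_N -> {RV P >-> R}).
Hypothesis indep : mutually_independent (@multi_index N) X.
Hypothesis mean0 : forall i, multi_index i ->
  (\int[distribution P (X i)]_x x%:E = 0)%E.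
Hypothesis var1 : forall i, multi_index i ->
  (\int[distribution P (X i)]_x (x ^+ 2)%:E = 1)%E.
Hypothesis beta_sum : (\sum_(2 <= p <oo) (2 ^+ p * beta p ^+ 2)%:E < +oo)%E.

Let disorder w (i : seq 'I_N) : R := X i w.

Let layer0 s p w : R :=
  if (2 <= p)%N then layer beta (disorder w) p s else 0.

Let layer0_moment s p :
  P.-integrable setT (fun w => (layer0 s p w ^+ 2)%:E) /\
  \int[P]_w (layer0 s p w ^+ 2) <=
    if (2 <= p)%N then N%:R * beta p ^+ 2 else 0.
Proof.
rewrite /layer0; case: ifPn => p2; last first.
  under eq_fun do rewrite expr0n /=; split; first exact: integrable0.
  under eq_Rintegral do rewrite expr0n /=.
  by rewrite Rintegral_cst// mul0r.
pose r := [seq tval t | t <- enum {: p.-tuple 'I_N}].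
pose b i := coupling N beta (size i) * (spin_prod s i : R).
have lE w : layer beta (disorder w) p s = \sum_(i <- r) b i * X i w.
  rewrite layerE big_map big_enum; apply: eq_bigr => t _.
  by rewrite /b /disorder; ring.
have ur : uniq r by rewrite map_inj_uniq ?enum_uniq//; exact: val_inj.
have rD : {in r, forall i, multi_index i}.
  by move=> i /mapP[t _ ->]; rewrite /multi_index /= size_tuple.
have [i1 e1] := second_moment_sum indep mean0 var1 b ur rD.
under eq_fun do rewrite lE; split => //.
under eq_Rintegral do rewrite lE.
rewrite e1 big_map big_enum /=.
rewrite (eq_bigr (fun=> coupling N beta p ^+ 2)); last first.
  move=> t _; rewrite /b size_tuple exprMn -[X in _ * X]real_normK ?num_real//.
  by rewrite normr_spin_prod expr1n mulr1.
rewrite sumr_const card_tuple card_ord.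
have := @sum_coupling_pow_le 2 p (-1) p2.
rewrite mulr_natl powRN invrK powRr1// [X in _ -> _ <= X]mulrC; apply.
by rewrite opprK; lra.
Qed.

Let measurable_layer0 s p : measurable_fun setT (layer0 s p).
Proof.
rewrite /layer0; case: (2 <= p)%N; last exact: measurable_cst.
under eq_fun do rewrite layerE.
apply: measurable_sum => i; apply: measurable_funM => //.
exact: measurable_funM.
Qed.

Let series_layer0 s w M :
  series (fun p => layer0 s p w) M = \sum_(2 <= p < M) layer beta (disorder w) p s.
Proof.
rewrite /series /= (big_nat_widenl 2 0)// [RHS]big_mkcond /=.
by apply: eq_bigr => p _; rewrite /layer0.
Qed.

(** The multiples of the disorder that make up the [p]-th layer are orthogonal,
    so the second moment of the layer is at most [N * beta p ^+ 2]. *)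
Lemma ae_cvg_truncated_hamiltonian :
  {ae P, forall w, forall s,
    truncated_hamiltonian beta h M (disorder w) s @[M --> \oo] -->
    hamiltonian beta h (disorder w) s}.
Proof.
have S0 : (0 <= \sum_(2 <= p <oo) (2 ^+ p * beta p ^+ 2)%:E)%E.
  by apply: nneseries_ge0 => p _ _; rewrite lee_fin mulr_ge0 ?sqr_ge0 ?exprn_ge0.
have Sfin : (\sum_(2 <= p <oo) (2 ^+ p * beta p ^+ 2)%:E)%E \is a fin_num.
  by rewrite ge0_fin_numE.
have cvg1 s : {ae P, forall w, cvgn (series (fun p => layer0 s p w))}.
  apply: (@ae_cvg_series _ _ _ P (layer0 s)
    (fun p => if (2 <= p)%N then N%:R * beta p ^+ 2 else 0)
    (N%:R * fine (\sum_(2 <= p <oo) (2 ^+ p * beta p ^+ 2)%:E)%E)) => //.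
  - by move=> p; have [] := layer0_moment s p.
  - by move=> p; have [] := layer0_moment s p.
  - move=> M; have -> : \sum_(0 <= p < M) 2 ^+ p *
        (if (2 <= p)%N then N%:R * beta p ^+ 2 else 0) =
        N%:R * \sum_(2 <= p < M) 2 ^+ p * beta p ^+ 2.
      rewrite (big_nat_widenl 2 0)// [X in _ * X]big_mkcond /= mulr_sumr.
      by apply: eq_bigr => p _; case: ifP => _; rewrite ?mulr0// mulrCA.
    apply: ler_wpM2l => //; rewrite -lee_fin fineK// -sumEFin.
    by apply: nneseries_lim_ge => p _ _;
      rewrite lee_fin mulr_ge0 ?sqr_ge0 ?exprn_ge0.
have cvg_all : {ae P, forall w, forall s : config N,
    cvgn (series (fun p => layer0 s p w))}.
  exact: (@filter_forall T _ (fun (s : config N) w =>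
    cvgn (series (fun p => layer0 s p w))) (almost_everywhere P)).
apply: filterS cvg_all => w cw s; apply: cvgD; last exact: cvg_cst.
have := cw s; rewrite (_ : series _ =
  (fun M => \sum_(2 <= p < M) layer beta (disorder w) p s))//.
by apply/funext => M; exact: series_layer0.
Qed.

Lemma measurable_hamiltonian s :
  measurable_fun setT (fun w => hamiltonian beta h (disorder w) s).
Proof.
apply: measurable_funD => //.
apply: (@measurable_limn _ _ _
  (fun M w => \sum_(2 <= p < M) layer beta (disorder w) p s)) => M.
apply: measurable_sum => p; under eq_fun do rewrite layerE.
apply: measurable_sum => i; apply: measurable_funM => //.
exact: measurable_funM.
Qed.

Hypothesis L1 : forall r, `|L r| <= 1.

Lemma fin_num_mean_replica_avg :
  ('E_P[fun w => replica_avg beta h (disorder w) L])%E \is a fin_num.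
Proof.
rewrite unlock; apply: integrable_fin_num => //.
apply: (@bounded_integrable _ _ _ P _ 1) => [|w]; last exact: normr_gibbs_avg.
by apply: measurable_gibbs_avg => s; exact: measurable_hamiltonian.
Qed.

Lemma cvg_mean_truncated :
  (\int[P]_w (gibbs_avg (truncated_hamiltonian beta h M (disorder w)) L)%:E
   @[M --> \oo] --> 'E_P[fun w => replica_avg beta h (disorder w) L])%E.
Proof.
rewrite unlock.
have mJ i : measurable_fun setT (fun w => disorder w i) by exact: measurable_funP.
have [] := @dominated_convergence _ _ _ P setT measurableT
  (fun M w => (gibbs_avg (truncated_hamiltonian beta h M (disorder w)) L)%:E)
  (fun w => (replica_avg beta h (disorder w) L)%:E) (cst 1%E).
- move=> M; apply/measurable_EFinP; exact: coord_measurable_gibbs_avg.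
- apply/measurable_EFinP; apply: measurable_gibbs_avg => s.
  exact: measurable_hamiltonian.
- have := ae_cvg_truncated_hamiltonian; apply: filterS => w cw _.
  apply: cvg_EFin; first exact: nearW.
  exact: cvg_gibbs_avg.
- exact: finite_measure_integrable_cst.
- by apply: aeW => w M _; rewrite /= lee_fin normr_gibbs_avg.
- by move=> _ _; exact.
Qed.

End truncation_limit.

(** * Universality of the Gibbs averages *)

Lemma expectation_comp_RV {R : realType} d (T : measurableType d)
    (P : probability T R) (X : {RV P >-> R}) (f : R -> R) :
  measurable_fun setT f -> (forall x, 0 <= f x) ->
  ('E_P[fun w => f (X w)] = \int[distribution P X]_x (f x)%:E)%E.
Proof.
move=> mf f0; rewrite unlock ge0_integral_distribution//.
exact/measurable_EFinP.
Qed.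

Section standardized_law.
Context {R : realType} d (T : measurableType d) (P : probability T R).
Context (X : {RV P >-> R}).
Hypotheses (X_mean : ('E_P[X] = 0)%E) (X_var : ('V_P[X] = 1)%E).

Lemma standardized_moment2 : (\int[distribution P X]_x (x ^+ 2)%:E = 1)%E.
Proof.
rewrite -(@expectation_comp_RV _ _ _ _ X (fun x => x ^+ 2)).
- rewrite -X_var /variance covariance.unlock X_mean /=.
  by congr expectation; apply/funext => w; rewrite !fctE /= subr0 expr2.
- exact: measurable_funX.
- by move=> x; exact: sqr_ge0.
Qed.

Lemma standardized_mean : (\int[distribution P X]_x x%:E = 0)%E.
Proof.
have X2 : (\int[distribution P X]_x (`|x| ^+ 2)%:E < +oo)%E.
  rewrite (eq_integral (fun x : R => (x ^+ 2)%:E)) ?standardized_moment2 ?ltry//.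
  by move=> x _; rewrite -normrX ger0_norm// sqr_ge0.
have X1 := integrable_monomial X2 (isT : (1 <= 2)%N).
have {}X1 : (distribution P X).-integrable setT (fun x : R => x%:E).
  by apply: eq_integrable X1 => // x _; rewrite expr1.
rewrite integral_distribution//; last exact: integrable_comp_RV X1.
by rewrite -X_mean unlock.
Qed.

End standardized_law.

Lemma Ckm2_natr (R : realType) n :
  (3 * n * Ckm 2 (2 * n))%N%:R = 96 * n%:R ^+ 3 :> R.
Proof.
have -> : Ckm 2 (2 * n) = (8 * (2 * n) ^ 2)%N by [].
by rewrite -natrX -natrM; congr _%:R; rewrite !expnS expn0; ring.
Qed.

Lemma Ckm3_natr (R : realType) n :
  (2 * n * Ckm 3 (2 * n))%N%:R = 2 ^+ 10 * n%:R ^+ 4 :> R.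
Proof.
have -> : (2 * n * Ckm 3 (2 * n) = 2 ^ 10 * n ^ 4)%N.
  have -> : Ckm 3 (2 * n) = (2 ^ 6 * (2 * n) ^ 3)%N by [].
  by rewrite expnMn; ring.
by rewrite (natrM R (2 ^ 10) (n ^ 4)) !natrX.
Qed.

Lemma Ckm4_natr (R : realType) n :
  (5 * n * Ckm 4 (2 * n))%N%:R = 80 * 2 ^+ 10 * n%:R ^+ 5 :> R.
Proof.
have -> : (5 * n * Ckm 4 (2 * n) = 80 * 2 ^ 10 * n ^ 5)%N.
  have -> : Ckm 4 (2 * n) = (2 ^ 10 * (2 * n) ^ 4)%N by [].
  by rewrite expnMn; ring.
by rewrite (natrM R (80 * 2 ^ 10) (n ^ 5)) (natrM R 80 (2 ^ 10)) !natrX.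
Qed.

Section universality.
Context {R : realType} (N n : nat) (beta : nat -> R) (h : R).
Hypotheses (N1 : (1 <= N)%N) (beta_ge0 : forall p, (2 <= p)%N -> 0 <= beta p).
Hypothesis beta_sum : (\sum_(2 <= p <oo) (2 ^+ p * beta p ^+ 2)%:E < +oo)%E.
Context d0 (T0 : measurableType d0) (P0 : probability T0 R) (y0 : {RV P0 >-> R}).
Hypotheses (y0_mean : ('E_P0[y0] = 0)%E) (y0_var : ('V_P0[y0] = 1)%E).
Context dy (Ty : measurableType dy) (Py : probability Ty R)
  (y : seq 'I_N -> {RV Py >-> R}).
Hypothesis y_iid : iid_with_law (@multi_index N) y (distribution P0 y0).
Context dg (Tg : measurableType dg) (Pg : probability Tg R)
  (g : seq 'I_N -> {RV Pg >-> R}).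
Hypothesis g_iid : iid_with_law (@multi_index N) g (normal_prob (0 : R) 1).
Context (L : {ffun 'I_n -> config N} -> R).
Hypothesis L1 : forall r, `|L r| <= 1.

Local Notation mu := (distribution P0 y0).
Local Notation F M J := (gibbs_avg (truncated_hamiltonian beta h M J) L).

Let mean_y M := \int[Py]_w F M (fun i => y i w).
Let mean_g M := \int[Pg]_w F M (fun i => g i w).

Let multi_indexM M i : i \in multi_indices N M -> multi_index i.
Proof. by rewrite mem_multi_indices => /andP[]. Qed.

Let integral_y i (f : R -> \bar R) : multi_index i ->
  (\int[distribution Py (y i)]_x f x = \int[mu]_x f x)%E.
Proof.
by move=> im; apply: eq_measure_integral => A mA _; exact: y_iid.2.
Qed.

Lemma avg_dist_le (B : \bar R) :
  (forall M, (`|mean_g M - mean_y M|%:E <= B)%E) ->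
  (`|'E_Pg[fun w => replica_avg beta h (fun i => g i w) L]
     - 'E_Py[fun w => replica_avg beta h (fun i => y i w) L]| <= B)%E.
Proof.
move=> MB.
have cy : (\int[Py]_w (F M (fun i => y i w))%:E @[M --> \oo] -->
    'E_Py[fun w => replica_avg beta h (fun i => y i w) L])%E.
  apply: cvg_mean_truncated => //; first exact: y_iid.1.
  - by move=> i im; rewrite integral_y// standardized_mean.
  - by move=> i im; rewrite integral_y// standardized_moment2.
have cg : (\int[Pg]_w (F M (fun i => g i w))%:E @[M --> \oo] -->
    'E_Pg[fun w => replica_avg beta h (fun i => g i w) L])%E.
  apply: cvg_mean_truncated => //; first exact: g_iid.1.
  - by move=> i im; apply: gaussian_law_mean; exact: g_iid.2.
  - by move=> i im; apply: gaussian_law_moment2; exact: g_iid.2.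
have fy : ('E_Py[fun w => replica_avg beta h (fun i => y i w) L])%E \is a fin_num.
  exact: fin_num_mean_replica_avg.
have cB : (`|\int[Pg]_w (F M (fun i => g i w))%:E
    - \int[Py]_w (F M (fun i => y i w))%:E| @[M --> \oo] -->
    `|'E_Pg[fun w => replica_avg beta h (fun i => g i w) L]
     - 'E_Py[fun w => replica_avg beta h (fun i => y i w) L]|)%E.
  by apply: cvg_abse; apply: cvgeB => //; rewrite fin_num_adde_defl// fin_numN.
rewrite -(cvg_lim _ cB)//; apply: lime_le.
  by apply/cvg_ex; eexists; exact: cB.
apply: nearW => M; apply: le_trans (MB M).
by rewrite -!(@EFin_bounded_Rintegral _ 1) => // *; rewrite ?normr_gibbs_avg//;
  apply: coord_measurable_gibbs_avg => i; exact: measurable_funP.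
Qed.

Let restrict_multi_indices M (J : seq 'I_N -> R) :
  F M (fun j => if j \in multi_indices N M then J j else 0) = F M J.
Proof.
congr gibbs_avg; apply/funext => s; rewrite !truncated_hamiltonianE.
by congr (_ + _); apply: eq_big_seq => j ->.
Qed.

Lemma mean_truncated_dist_le M (eps : nat -> R) :
  (forall i J, i \in multi_indices N M ->
    `|\int[distribution Pg (g i)]_x F M (set_coord J i x)
      - \int[mu]_x F M (set_coord J i x)| <= eps (size i)) ->
  `|mean_g M - mean_y M| <= \sum_(2 <= p < M) (N ^ p)%:R * eps p.
Proof.
move=> Feps; rewrite -sum_multi_indices_size.
have -> : mean_y M =
    \int[Py]_w F M (fun j => if j \in multi_indices N M then y j w else 0).
  by apply: eq_Rintegral => w _; rewrite restrict_multi_indices.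
have -> : mean_g M =
    \int[Pg]_w F M (fun j => if j \in multi_indices N M then g j w else 0).
  by apply: eq_Rintegral => w _; rewrite restrict_multi_indices.
apply: (@lindeberg_replacement _ _ _ _ _ Py Pg _ y g (@multi_index N)
  y_iid.1 g_iid.1 (fun J => F M J) 1 (fun i => eps (size i)) (multi_indices N M)
  (@coord_measurable_gibbs_avg _ _ _ _ _ _ _) _ (uniq_multi_indices N M)).
- by move=> J; exact: normr_gibbs_avg.
- exact: multi_indexM.
- move=> i J iM; have := Feps i J iM.
  by rewrite {2}/Rintegral -(@integral_y i _ (multi_indexM iM)).
Qed.

Let coord_measurable_line M J i : measurable_fun setT (fun x => F M (set_coord J i x)).
Proof.
apply: coord_measurable_gibbs_avg => j; rewrite /set_coord.
by case: (j == i); [exact: measurable_id|exact: measurable_cst].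
Qed.

Let EFin_Rintegral (f : R -> R) : mu.-integrable setT (EFin \o f) ->
  (\int[mu]_x f x)%:E = (\int[mu]_x (f x)%:E)%E.
Proof. by move=> fi; rewrite /Rintegral fineK//; exact: integrable_fin_num. Qed.

Let beta_pow_ge0 k p : (2 <= p)%N -> 0 <= beta p ^+ k.
Proof. by move=> p2; rewrite exprn_ge0 ?beta_ge0. Qed.

Let partial_ge0 m k M : (2 <= m)%N -> 0 <= \sum_(m <= p < M) beta p ^+ k.
Proof.
move=> m2; rewrite big_nat_cond; apply: sumr_ge0 => p /andP[/andP[mp _] _].
by rewrite beta_pow_ge0// (leq_trans m2).
Qed.

Let partial_le m k M : (2 <= m)%N ->
  ((\sum_(m <= p < M) beta p ^+ k)%:E <= \sum_(m <= p <oo) (beta p ^+ k)%:E)%E.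
Proof.
move=> m2; rewrite -sumEFin; apply: nneseries_lim_ge => p mp _.
by rewrite lee_fin beta_pow_ge0// (leq_trans m2).
Qed.

(** The total cost of order [p] is governed by
    [N ^ p * c_p ^ 3 = beta p ^ 3 * N ^ ((3 - p) / 2)], which is of the right size
    only from [p = 4] on. *)
Theorem universality_two_moments :
  beta 2%N = 0 -> beta 3%N = 0 ->
  ('E_P0[fun w => (`|y0 w| ^+ 3)%R] < +oo)%E ->
  (`|'E_Pg[fun w => replica_avg beta h (fun i => g i w) L]
     - 'E_Py[fun w => replica_avg beta h (fun i => y i w) L]| <=
     ((3 * n * Ckm 2 (2 * n))%N%:R / (2 * N%:R `^ 2^-1))%R%:E
     * 'E_P0[fun w => (`|y0 w| ^+ 3)%R]
     * \sum_(4 <= p <oo) (beta p ^+ 3)%:E)%E.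
Proof.
move=> beta2 beta3.
have mX3 : measurable_fun setT (fun x : R => `|x| ^+ 3).
  by apply: measurable_funX; exact: normr_measurable.
rewrite (@expectation_comp_RV _ _ _ _ y0 (fun x => `|x| ^+ 3))// => m3.
rewrite -(EFin_Rintegral (integrable_monomial_norm m3 (leqnn 3))).
set E3 := \int[mu]_x (`|x| ^+ 3).
have E30 : 0 <= E3 by apply: Rintegral_ge0 => x _; exact: exprn_ge0.
apply: avg_dist_le => M.
pose K p : R := 2 ^+ 'C(4, 2) * (n%:R * coupling N beta p) ^+ 3 / 3`!%:R.
have dist : `|mean_g M - mean_y M| <=
    \sum_(2 <= p < M) (N ^ p)%:R * (3 * K p * E3).
  apply: mean_truncated_dist_le => i J iM.
  have i2 : (2 <= size i)%N := multi_indexM iM.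
  have c0 : 0 <= coupling N beta (size i) by rewrite divr_ge0 ?beta_ge0 ?powR_ge0.
  have [t [_ tF]] := gibbs_avg_taylor h J L1 beta_ge0 iM.
  apply: (@gauss_dist_two_moments _ (distribution Pg (g i)) mu _ t (K (size i)) 1).
  - by apply: g_iid.2; exact: multi_indexM iM.
  - exact: standardized_mean.
  - exact: standardized_moment2.
  - exact: m3.
  - by rewrite divr_ge0// mulr_ge0 ?exprn_ge0// mulr_ge0.
  - exact: coord_measurable_line.
  - by move=> x; exact: normr_gibbs_avg.
  - exact: tF.
pose rN : R := (N%:R `^ 2^-1)^-1.
have rN0 : 0 <= rN by rewrite invr_ge0 powR_ge0.
have term p : (2 <= p < M)%N -> (N ^ p)%:R * (3 * K p * E3) <=
    32 * n%:R ^+ 3 * E3 * rN * (if (4 <= p)%N then beta p ^+ 3 else 0).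
  move=> /andP[p2 _].
  rewrite [leLHS](_ : _ = 32 * n%:R ^+ 3 * E3 * ((N ^ p)%:R * coupling N beta p ^+ 3));
    last first.
    rewrite /K (_ : 'C(4, 2) = 6%N)// (_ : 3`! = 6%N)//.
    by rewrite exprMn; field.
  rewrite -[leRHS]mulrA; apply: ler_wpM2l.
    by rewrite !mulr_ge0 ?exprn_ge0.
  case: ifPn => p4; last first.
    have : p = 2%N \/ p = 3%N by move: p p2 p4 => [|[|[|[|p]]]]//; auto.
    by case=> ->; rewrite /coupling (beta2, beta3) mul0r expr0n /= !mulr0.
  rewrite [leRHS]mulrC; apply: sum_coupling_pow_le => //.
  have : 4 <= p%:R :> R by rewrite ler_nat.
  lra.
apply: (@le_trans _ _ (32 * n%:R ^+ 3 * E3 * rN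
    * \sum_(4 <= p < M) beta p ^+ 3)%:E).
  rewrite lee_fin; apply: (le_trans dist).
  apply: (le_trans (ler_sum_nat term)).
  rewrite -mulr_sumr; apply: ler_wpM2l; first by rewrite !mulr_ge0 ?exprn_ge0.
  rewrite (big_nat_widenl 4 2)// [leRHS]big_mkcond /=.
  exact: lexx.
rewrite -EFinM EFinM; apply: lee_pmul.
- by rewrite lee_fin !mulr_ge0 ?exprn_ge0.
- by rewrite lee_fin partial_ge0.
- rewrite lee_fin [leLHS](_ : _ = 32 * n%:R ^+ 3 * rN * E3); last by ring.
  apply: ler_wpM2r => //; rewrite Ckm2_natr invfM -/rN.
  have : 0 <= n%:R ^+ 3 * rN by rewrite mulr_ge0 ?exprn_ge0.
  lra.
- exact: partial_le.
Qed.

(** Here [N ^ p * c_p ^ 4 = beta p ^ 4 * N ^ (2 - p)] and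
    [N ^ p * c_p ^ 5 = beta p ^ 5 * N ^ ((5 - 3 p) / 2)]; cutting at
    [a = N ^ (1/4)] multiplies the latter, at most [beta p ^ 5 / a ^ 2], by [a]. *)
Theorem universality_four_moments :
  (forall k, (1 <= k <= 4)%N ->
    ('E_P0[fun w => (y0 w ^+ k)%R] =
     \int[normal_prob (0 : R) 1]_x (x ^+ k)%:E)%E) ->
  (`|'E_Pg[fun w => replica_avg beta h (fun i => g i w) L]
     - 'E_Py[fun w => replica_avg beta h (fun i => y i w) L]| <=
     (2 * n * Ckm 3 (2 * n))%N%:R%:E
     * 'E_P0[fun w => (`|y0 w| ^+ 4
              * \1_[set w' | N%:R `^ 4^-1 <= `|y0 w'|] w)%R]
     * \sum_(2 <= p <oo) (beta p ^+ 4)%:E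
     + ((5 * n * Ckm 4 (2 * n))%N%:R / (24 * N%:R `^ 4^-1))%R%:E
     * 'E_P0[fun w => (`|y0 w| ^+ 4)%R]
     * \sum_(2 <= p <oo) (beta p ^+ 5)%:E)%E.
Proof.
move=> moments.
pose a : R := N%:R `^ 4^-1.
have a1 : 1 <= a.
  rewrite -[leLHS](powRr0 (N%:R : R)); apply: ler_powR; first by rewrite ler1n.
  by rewrite invr_ge0.
have mX4 : measurable_fun setT (fun x : R => `|x| ^+ 4).
  by apply: measurable_funX; exact: normr_measurable.
have m4E : (\int[mu]_x (x ^+ 4)%:E = \int[mu]_x (`|x| ^+ 4)%:E)%E.
  by apply: eq_integral => x _; rewrite -normrX ger0_norm// exprn_even_ge0.
have m4 : (\int[mu]_x (`|x| ^+ 4)%:E < +oo)%E.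
  rewrite -m4E -(@expectation_comp_RV _ _ _ _ y0 (fun x => x ^+ 4)).
  - by rewrite moments//; apply: (le_lt_trans gauss_moment4_le); rewrite ltry.
  - exact: measurable_funX.
  - by move=> x; rewrite exprn_even_ge0.
have mu_moments k : (1 <= k <= 4)%N ->
    (\int[mu]_x (x ^+ k)%:E = \int[normal_prob (0 : R) 1]_x (x ^+ k)%:E)%E.
  move=> k14; rewrite -moments// unlock integral_distribution//.
  - by apply/measurable_EFinP; exact: measurable_funX.
  - apply: integrable_comp_RV; apply: (integrable_monomial m4).
    by case/andP: k14.
have mA : measurable [set x : R | a <= `|x|].
  rewrite -[X in measurable X]setTI.
  rewrite [X in measurable (_ `&` X)](_ : _ = (fun x : R => `|x|) @^-1` `[a, +oo[%classic).
    exact: (@normr_measurable R setT measurableT).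
  by apply/seteqP; split => x /=; rewrite in_itv /= andbT.
pose tail (x : R) : R := `|x| ^+ 4 * \1_[set x | a <= `|x|] x.
have mtail : measurable_fun setT tail.
  by apply: measurable_funM => //; exact: measurable_indic.
have tail_ge0 x : 0 <= tail x by rewrite mulr_ge0 ?exprn_ge0.
have tail_le x : tail x <= `|x| ^+ 4.
  rewrite /tail ler_piMr ?exprn_ge0// indicE; by case: (x \in _); rewrite ?ler01.
have itail : mu.-integrable setT (EFin \o tail).
  apply: (le_integrable _ _ _ (integrable_monomial_norm m4 (leqnn 4))) => //.
    exact/measurable_EFinP.
  move=> x _; rewrite /= lee_fin (ger0_norm (tail_ge0 x)).
  by rewrite ger0_norm ?exprn_ge0.
have -> : ('E_P0[fun w => (`|y0 w| ^+ 4
    * \1_[set w' | N%:R `^ 4^-1 <= `|y0 w'|] w)%R] =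
    \int[mu]_x (tail x)%:E)%E.
  exact: (expectation_comp_RV y0 mtail).
rewrite (@expectation_comp_RV _ _ _ _ y0 (fun x => `|x| ^+ 4))//.
rewrite -(EFin_Rintegral (integrable_monomial_norm m4 (leqnn 4))).
rewrite -(EFin_Rintegral itail).
set E4 := \int[mu]_x (`|x| ^+ 4); set Et := \int[mu]_x (tail x).
have E40 : 0 <= E4 by apply: Rintegral_ge0 => x _; exact: exprn_ge0.
have Et0 : 0 <= Et by apply: Rintegral_ge0.
apply: avg_dist_le => M.
pose K4 p : R := 2 ^+ 'C(5, 2) * (n%:R * coupling N beta p) ^+ 4 / 4`!%:R.
pose K5 p : R := 2 ^+ 'C(6, 2) * (n%:R * coupling N beta p) ^+ 5 / 5`!%:R.
have dist : `|mean_g M - mean_y M| <=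
    \sum_(2 <= p < M) (N ^ p)%:R * (2 * K4 p * Et + 4 * K5 p * a * E4).
  apply: mean_truncated_dist_le => i J iM.
  have i2 : (2 <= size i)%N := multi_indexM iM.
  have c0 : 0 <= coupling N beta (size i) by rewrite divr_ge0 ?beta_ge0 ?powR_ge0.
  have [t [tle tF]] := gibbs_avg_taylor h J L1 beta_ge0 iM.
  apply: (@gauss_dist_four_moments _ (distribution Pg (g i)) mu _ t (K4 (size i))
    (K5 (size i)) a 1).
  - by apply: g_iid.2; exact: multi_indexM iM.
  - exact: mu_moments.
  - by rewrite divr_ge0// mulr_ge0 ?exprn_ge0// mulr_ge0.
  - by rewrite divr_ge0// mulr_ge0 ?exprn_ge0// mulr_ge0.
  - exact: a1.
  - exact: coord_measurable_line.
  - by move=> x; exact: normr_gibbs_avg.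
  - exact: tle.
  - exact: tF.
  - exact: tF.
pose rN : R := a^-1.
have rN0 : 0 <= rN by rewrite invr_ge0 (le_trans ler01).
have q0 : 0 <= 2 ^+ 10 :> R by rewrite exprn_ge0.
have term p : (2 <= p < M)%N ->
    (N ^ p)%:R * (2 * K4 p * Et + 4 * K5 p * a * E4) <=
    2 ^+ 10 * n%:R ^+ 4 * Et * beta p ^+ 4
    + 2 * 2 ^+ 10 * n%:R ^+ 5 * rN * E4 * beta p ^+ 5.
  move=> /andP[p2 _].
  have p2' : 2 <= p%:R :> R by rewrite ler_nat.
  have c4 : (N ^ p)%:R * coupling N beta p ^+ 4 <= beta p ^+ 4.
    rewrite -[leRHS]divr1 -[X in _ / X](powRr0 (N%:R : R)).
    by apply: sum_coupling_pow_le => //; lra.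
  have c5 : (N ^ p)%:R * coupling N beta p ^+ 5 * a <= rN * beta p ^+ 5.
    have a0 : 0 < a by rewrite (lt_le_trans ltr01).
    have aa : N%:R `^ 2^-1 = a * a.
      rewrite -powRD; first by congr (_ `^ _); field.
      by rewrite pnatr_eq0 -lt0n N1 implybT.
    have : (N ^ p)%:R * coupling N beta p ^+ 5 <= beta p ^+ 5 / N%:R `^ 2^-1.
      by apply: sum_coupling_pow_le => //; lra.
    move=> /(ler_wpM2r (ltW a0)) /le_trans; apply.
    by rewrite aa invfM mulrA mulfVK ?gt_eqF// mulrC.
  rewrite mulrDr; apply: lerD.
    rewrite [leLHS](_ : _ = 2 ^+ 10 * n%:R ^+ 4 * Et / 12 *
      ((N ^ p)%:R * coupling N beta p ^+ 4)); last first.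
      by rewrite /K4 (_ : 'C(5, 2) = 10%N)// (_ : 4`! = 24%N)// exprMn; field.
    apply: ler_pM => //; first by rewrite !mulr_ge0 ?exprn_ge0.
      by rewrite mulr_ge0// exprn_ge0// divr_ge0 ?beta_ge0 ?powR_ge0.
    rewrite ler_pdivrMr//; have : 0 <= 2 ^+ 10 * n%:R ^+ 4 * Et.
      by rewrite !mulr_ge0 ?exprn_ge0.
    by move=> ?; lra.
  rewrite [leLHS](_ : _ = 2 ^+ 10 * n%:R ^+ 5 * E4 * (16 / 15) *
    ((N ^ p)%:R * coupling N beta p ^+ 5 * a)); last first.
    rewrite /K5 (_ : 'C(6, 2) = 15%N)// (_ : 5`! = 120%N)// exprMn.
    by rewrite -[15%N]/(10 + 5)%N exprD; field.
  rewrite [leRHS](_ : _ = 2 ^+ 10 * n%:R ^+ 5 * E4 * 2 * (rN * beta p ^+ 5));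
    last by ring.
  apply: ler_pM => //; first by rewrite !mulr_ge0 ?exprn_ge0.
    apply: mulr_ge0; last exact: le_trans ler01 a1.
    by rewrite mulr_ge0// exprn_ge0// divr_ge0 ?beta_ge0 ?powR_ge0.
  by apply: ler_wpM2l; [rewrite !mulr_ge0 ?exprn_ge0|lra].
apply: (@le_trans _ _
    ((2 ^+ 10 * n%:R ^+ 4 * Et)%:E * (\sum_(2 <= p < M) beta p ^+ 4)%:E +
    (2 * 2 ^+ 10 * n%:R ^+ 5 * rN * E4)%:E * (\sum_(2 <= p < M) beta p ^+ 5)%:E)%E).
  rewrite -!EFinM -EFinD lee_fin; apply: (le_trans dist).
  apply: (le_trans (ler_sum_nat term)).
  by rewrite big_split /= -!mulr_sumr.
apply: leeD; rewrite -[X in (_ <= X * _)%E]EFinM; apply: lee_pmul.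
- by rewrite lee_fin !mulr_ge0 ?exprn_ge0.
- by rewrite lee_fin partial_ge0.
- by rewrite lee_fin Ckm3_natr.
- exact: partial_le.
- by rewrite lee_fin !mulr_ge0 ?exprn_ge0.
- by rewrite lee_fin partial_ge0.
- rewrite lee_fin; apply: ler_wpM2r => //.
  rewrite Ckm4_natr invfM -/a -/rN.
  have : 0 <= 2 ^+ 10 * n%:R ^+ 5 * rN by rewrite !mulr_ge0 ?exprn_ge0.
  lra.
- exact: partial_le.
Qed.

End universality.

Theorem theorem4 (R : realType) (N n : nat) (hN : (1 <= N)%N) (hn : (1 <= n)%N)
    (beta : nat -> R) (h : R)
    (beta_ge0 : forall p, (2 <= p)%N -> 0 <= beta p)
    (beta_sum : (\sum_(2 <= p <oo) (2 ^+ p * beta p ^+ 2)%:E < +oo)%E)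
    (* the reference variable y, with mean zero and variance one *)
    (d0 : measure_display) (T0 : measurableType d0) (P0 : probability T0 R)
    (y0 : {RV P0 >-> R})
    (y0_mean : ('E_P0[y0] = 0)%E) (y0_var : ('V_P0[y0] = 1)%E)
    (* the disorder with the law of y *)
    (dy : measure_display) (Ty : measurableType dy) (Py : probability Ty R)
    (y : seq 'I_N -> {RV Py >-> R})
    (y_iid : iid_with_law (@multi_index N) y (distribution P0 y0))
    (* the standard Gaussian disorder *)
    (dg : measure_display) (Tg : measurableType dg) (Pg : probability Tg R)
    (g : seq 'I_N -> {RV Pg >-> R})
    (g_iid : iid_with_law (@multi_index N) g (normal_prob (0 : R) 1))
    (L : {ffun 'I_n -> config N} -> R) (L_le1 : forall s, `|L s| <= 1) :
  let avg_y := 'E_Py[fun w => replica_avg beta h (fun i => y i w) L]%E in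
  let avg_g := 'E_Pg[fun w => replica_avg beta h (fun i => g i w) L]%E in
  (beta 2%N = 0 -> beta 3%N = 0 ->
    ('E_P0[fun w => (`|y0 w| ^+ 3)%R] < +oo)%E ->
    (`|avg_g - avg_y| <=
       ((3 * n * Ckm 2 (2 * n))%N%:R / (2 * N%:R `^ 2^-1))%R%:E
       * 'E_P0[fun w => (`|y0 w| ^+ 3)%R]
       * \sum_(4 <= p <oo) (beta p ^+ 3)%:E)%E)
  /\
  ((forall k, (1 <= k <= 4)%N ->
      ('E_P0[fun w => (y0 w ^+ k)%R] =
       \int[normal_prob (0 : R) 1]_x (x ^+ k)%:E)%E) ->
    (`|avg_g - avg_y| <=
       (2 * n * Ckm 3 (2 * n))%N%:R%:E
       * 'E_P0[fun w => (`|y0 w| ^+ 4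
                * \1_[set w' | N%:R `^ 4^-1 <= `|y0 w'|] w)%R]
       * \sum_(2 <= p <oo) (beta p ^+ 4)%:E
       + ((5 * n * Ckm 4 (2 * n))%N%:R / (24 * N%:R `^ 4^-1))%R%:E
       * 'E_P0[fun w => (`|y0 w| ^+ 4)%R]
       * \sum_(2 <= p <oo) (beta p ^+ 5)%:E)%E).
Proof.
move=> avg_y avg_g; split; [move=> b2 b3 m3 | move=> mom].
  by apply: universality_two_moments.
by apply: universality_four_moments.
Qed.
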